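(* Let $X_{it}=\sigma_{it}Z_{it}$, $i,t\ge 1$, be the stochastic volatility model described in the context, and let $\mathbf X=\mathbf X_n=(X_{it})_{i=1,\ldots,p;\,t=1,\ldots,n}$, $\mathbf S=\mathbf X\mathbf X'$, and $\mathbf Y=\mathbf A^{1/2}\mathbf X$, so that $\mathbf Y\mathbf Y'=\mathbf A^{1/2}\mathbf S\mathbf A^{1/2}$. Assume the following. (1) $p=p_n\to\infty$ is an integer sequence of the form $p_n=n^{\beta}\ell(n)$, $n\ge 1$, where $\ell$ is a slowly varying function and $\beta\in(0,1]$. (2) For some $\alpha\in(0,2)\cup(2,4)$, constants $q_+,q_-\ge 0$ with $q_++q_-=1$ and a slowly varying function $L$, one has $\mathbb P(Z>x)\sim q_+L(x)x^{-\alpha}$ and $\mathbb P(Z<-x)\sim q_-L(x)x^{-\alpha}$ as $x\to\infty$; moreover $\mathbb E[Z]=0$ if $\mathbb E[|Z|]<\infty$. (3) $\mathbb E[\sigma^r]<\infty$ for all $r>0$. (4) $\mathbf A=\mathbf A_n$ is a sequence of deterministic, (symmetric) positive definite $p\times p$ matrices with uniformly bounded spectra, i.e. $\sup_n\|\mathbf A_n\|_2<\infty$. Then, as $n\to\infty$, $$a_{np}^{-2}\max_{i=1,\ldots,p}\big|\lambda_i(\mathbf A^{1/2}\mathbf S\mathbf A^{1/2})-\lambda_i(\operatorname{diag}(\mathbf S)\mathbf A)\big|\stackrel{\mathbb P}{\rightarrow}0.$$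
   Context: Stochastic volatility model: $(Z_{it})_{i,t\ge1}$ is a field of iid real random variables, $(\sigma_{it})_{i,t\ge 1}$ is a strictly stationary random field of non-negative random variables, the fields $(\sigma_{it})$ and $(Z_{it})$ are independent, and $X_{it}=\sigma_{it}Z_{it}$. $X,\sigma,Z$ denote generic elements of the respective fields. $(a_k)$ is a sequence of positive numbers with $k\,\mathbb P(|Z|>a_k)\to 1$ as $k\to\infty$, and $a_{np}$ is its element with index $k=np$, $p=p_n$. $\mathbf A^{1/2}$ is the symmetric positive definite square root of $\mathbf A$. $\|\mathbf C\|_2$ is the spectral norm and $\operatorname{diag}(\mathbf C)$ the diagonal matrix with the same diagonal as $\mathbf C$. $\lambda_1(\mathbf C)\ge\cdots\ge\lambda_p(\mathbf C)$ denote the ordered eigenvalues of a $p\times p$ matrix $\mathbf C$ with real eigenvalues; the matrix $\operatorname{diag}(\mathbf S)\mathbf A$ has real non-negative eigenvalues, namely those of $\mathbf A^{1/2}\operatorname{diag}(\mathbf S)\mathbf A^{1/2}$. *)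

(* Defs.v *)
From mathcomp Require Import all_boot all_order all_algebra.
From mathcomp Require Import all_classical all_reals all_analysis.

Set Implicit Arguments.
Unset Strict Implicit.
Unset Printing Implicit Defensive.

Import Order.TTheory GRing.Theory Num.Theory.
Import numFieldNormedType.Exports.

Local Open Scope classical_set_scope.
Local Open Scope ring_scope.

(* A random field is a family of random variables indexed by a type [I]. The
   fields of the model, indexed in the text by (i, t) with i, t >= 1, are
   indexed here by [nat * nat] counted from 0. *)
Section random_fields.
Context {d : measure_display} {T : measurableType d} {R : realType}.
Variable P : probability T R.

Definition cylinder (I : Type) : set (set (I -> R)) :=
  [set C | exists (i : I) (B : set R), measurable B /\ C = [set f | B (f i)]].

Definition product_sigma_algebra (I : Type) : set (set (I -> R)) :=
  <<s @cylinder I >>.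

Definition trajectory (I : Type) (X : I -> {RV P >-> R}) (w : T) : I -> R :=
  fun i => X i w.

Definition same_law (I : Type) (X Y : I -> {RV P >-> R}) : Prop :=
  forall C, product_sigma_algebra C ->
    P (trajectory X @^-1` C) = P (trajectory Y @^-1` C).

Definition independent_fields (I J : Type)
    (X : I -> {RV P >-> R}) (Y : J -> {RV P >-> R}) : Prop :=
  forall C D, product_sigma_algebra C -> product_sigma_algebra D ->
    P ((trajectory X @^-1` C) `&` (trajectory Y @^-1` D)) =
    (P (trajectory X @^-1` C) * P (trajectory Y @^-1` D))%E.

Definition mutually_independent (I : choiceType) (X : I -> {RV P >-> R}) : Prop :=
  forall (s : seq I) (B : I -> set R), uniq s ->
    (forall i, measurable (B i)) ->
    P (\bigcap_(i in [set` s]) (X i @^-1` B i)) =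
    (\prod_(i <- s) P (X i @^-1` B i))%E.

Definition identically_distributed (I : Type) (X : I -> {RV P >-> R}) : Prop :=
  forall i j (B : set R), measurable B ->
    distribution P (X i) B = distribution P (X j) B.

Definition iid (I : choiceType) (X : I -> {RV P >-> R}) : Prop :=
  mutually_independent X /\ identically_distributed X.

Definition strictly_stationary (X : nat * nat -> {RV P >-> R}) : Prop :=
  forall h k : nat, same_law (fun it => X ((it.1 + h)%N, (it.2 + k)%N)) X.

Definition cvg_in_probability0 (Y : nat -> T -> R) : Prop :=
  forall e : R, 0 < e -> P [set w | e < `|Y n w|] @[n --> \oo] --> 0%E.

End random_fields.

Section regular_variation.
Context {R : realType}.

(* [L] only matters on a neighbourhood of +oo. *)
Definition slowly_varying (L : R -> R) : Prop :=
  (exists x0 : R, measurable_fun `[x0, +oo[ L /\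
                  forall x, x0 <= x -> 0 < L x) /\
  forall c : R, 0 < c -> L (c * x) / L x @[x --> +oo] --> (1 : R).

(* [f ~ q * g] at +oo, with the usual convention that it means [f = o(g)] when
   [q = 0]. *)
Definition asymptotic_to (f : R -> R) (q : R) (g : R -> R) : Prop :=
  f x / g x @[x --> +oo] --> q.

End regular_variation.

Section matrices.
Context {R : realType}.

Definition sym_posdef (p : nat) (A : 'M[R]_p) : Prop :=
  A^T = A /\ forall x : 'cV[R]_p, x != 0 -> 0 < (x^T *m A *m x) 0 0.

(* The symmetric positive definite B such that B^2 = A; the default value 0 is
   only used when A is not itself symmetric positive definite. *)
Definition mxsqrt (p : nat) (A : 'M[R]_p) : 'M[R]_p :=
  xget 0 [set B | sym_posdef B /\ B *m B = A].

Definition euclidean_norm (p : nat) (x : 'cV[R]_p) : R :=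
  Num.sqrt (\sum_(i < p) x i 0 ^+ 2).

Definition spectral_norm (p : nat) (C : 'M[R]_p) : R :=
  sup [set euclidean_norm (C *m x) | x in [set x | euclidean_norm x <= 1]].

Definition mxdiag_part (p : nat) (C : 'M[R]_p) : 'M[R]_p :=
  diag_mx (\row_(i < p) C i i).

(* Eigenvalues are counted with their algebraic multiplicity. *)
Definition is_ordered_spectrum (p : nat) (C : 'M[R]_p) (s : seq R) : Prop :=
  sorted >=%R s /\ char_poly C = \prod_(x <- s) ('X - x%:P).

(* The default value [::] is only used when some eigenvalue is not real. *)
Definition ordered_spectrum (p : nat) (C : 'M[R]_p) : seq R :=
  xget [::] [set s | is_ordered_spectrum C s].

(* Position i, counted from 0, holds the (i+1)-st largest eigenvalue. *)
Definition eigval (p : nat) (C : 'M[R]_p) (i : 'I_p) : R :=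
  nth 0 (ordered_spectrum C) i.

Lemma ordered_spectrum_unique (p : nat) (C : 'M[R]_p) (s : seq R) :
  is_ordered_spectrum C s -> ordered_spectrum C = s /\ size s = p.
Proof.
move=> Cs; have [_ Es] := Cs; split; last first.
  by apply: succn_inj; rewrite -(size_char_poly C) Es size_prod_XsubC.
have: is_ordered_spectrum C (ordered_spectrum C).
  by rewrite /ordered_spectrum; case: xgetP => [? -> //|/(_ s)]; case.
case=> sorted_t Et; apply: (sorted_eq _ _ sorted_t Cs.1).
- by move=> y x z /= yx zy; exact: le_trans zy yx.
- by move=> x y /=; rewrite andbC => /le_anti.
- by apply: prod_XsubC_eq; rewrite -Et -Es.
Qed.

End matrices.

Definition sv_data (R : realType) (d : measure_display) (T : measurableType d)
    (P : probability T R) (sigma Z : nat * nat -> {RV P >-> R})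
    (p n : nat) (w : T) : 'M[R]_(p, n) :=
  \matrix_(i < p, t < n)
    (sigma (nat_of_ord i, nat_of_ord t) w * Z (nat_of_ord i, nat_of_ord t) w).

(* Main.v *)
Require Import Defs.
From HB Require Import structures.
From mathcomp Require Import all_boot all_order all_algebra.
From mathcomp Require Import fingroup perm complex.
From mathcomp Require Import all_classical all_reals all_analysis.
From mathcomp Require Import measurable_realfun.
From mathcomp Require Import ring lra zify.

Set Implicit Arguments.
Unset Strict Implicit.
Unset Printing Implicit Defensive.

Import Order.TTheory GRing.Theory Num.Theory.
Import numFieldNormedType.Exports.

Local Open Scope classical_set_scope.
Local Open Scope ring_scope.

(** The matrix diag(S) A has the spectrum of the symmetric matrix
    A^(1/2) diag(S) A^(1/2). By Weyl's inequality every eigenvalue gap is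
    therefore at most the spectral norm of A times that of F = S - diag(S)
    ([eigval_diag_trace_bound]). With N = n p, it remains to show that
    the norm of F is of smaller order than a_N^2 in probability, and this is done
    by the moment method: for K even, the K-th power of the norm is at most
    tr(F^K).

    Let Z be cut off at a level b slightly above N^(1/alpha); with probability
    tending to 1 no entry changes. The trace of F^K is a sum over walks that
    alternate between rows and columns of the data matrix, each step from a row
    to a column or back crossing one cell ([offdiag_power]). Since the two fields
    are independent, the expectation of the product along a walk splits: the
    volatilities contribute a bounded factor, having all moments, and the noise
    contributes one moment of the truncated variable for each distinct cell
    ([field_prod_bound]). Measured in units of a_N, and up to small powers of N, a
    cell visited m times costs 1/N if m = 1, because Z is centred, or m >= 4,
    because alpha < 4; it costs at most N^(-1/2-delta) if m = 2 or 3, where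
    delta = min(1/2, 2/alpha - 1/2) is positive ([truncated_moment_bound],
    [moment_exponent]).

    Against this cost stand about p^R n^C walks with R distinct rows and C
    distinct columns. If E cells are visited then R + C <= E + 1, as a walk is
    connected, and 2 C <= E, as consecutive rows of a walk differ: this is the
    effect of removing the diagonal of S. Since p is at most about N^(1/2), the
    number of walks is at most about N^(1/2+E/2). If H of the cells are visited
    once or at least four times, the total exponent is at most about
    1/2 - H/2 - delta (E - H). It is negative if H >= 2, if H = 1
    (since then E >= 2), and if H = 0 once K is large, since then 2K <= 3E
    ([walk_weight]). So K is fixed first, of order 1/delta, and the small powers
    of N are chosen afterwards.

    Regular variation enters through three facts: Z has all absolute moments of
    order less than alpha ([abs_moment_integrable]), a_k is eventually at least
    k^(1/alpha-e) for every e > 0 ([quantile_lower]), and p is at most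
    N^(1/2+e) ([dimension_exponent]). The first two follow from the behaviour of the
    tail along x, 2x, 4x, ..., as the tail is monotone. The third concerns a
    function that need not be monotone and needs the uniform convergence
    theorem for measurable slowly varying functions ([uniform_increments]).

    Finally, probabilities are only meaningful on measurable sets, so the
    eigenvalue gap has to be a measurable function of the sample
    ([measurable_eigval_gap]); this follows from its Lipschitz continuity. *)

(** * Real symmetric matrices *)

Section linear_algebra.
Context {R : realType}.

Definition qform n (A : 'M[R]_n) (x : 'rV[R]_n) : R := (x *m A *m x^T) 0 0.

(** Over the complex numbers there is an eigenvector v. Pairing the eigenvalue
    equation with the conjugate of v shows that the eigenvalue is real, so it is
    a root of the real characteristic polynomial and has a real eigenvector. *)
Lemma sym_eigenvector n (A : 'M[R]_n.+1) : A^T = A ->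
  exists (a : R) (v : 'rV[R]_n.+1), v != 0 /\ v *m A = a *: v.
Proof.
move=> symA; pose f := real_complex R; pose C := map_mx f A.
have [z /eigenvalueP[v vC v0]] := eigenvalue_closed C isT.
have CC : C^T = C by rewrite /C map_trmx symA.
have realC : map_mx Num.conj C = C.
  by apply/matrixP=> i j; rewrite !mxE /f /=; simpc.
pose w := (map_mx Num.conj v)^T.
have nv : (v *m w) 0 0 != 0.
  rewrite mxE psumr_eq0; last by move=> i _; rewrite !mxE mul_conjC_ge0.
  apply: contra v0 => /allP h; apply/eqP/rowP=> i; rewrite mxE.
  have := h i (mem_index_enum _); rewrite /= !mxE mul_conjC_eq0.
  by move/eqP.
have e1 : (v *m C *m w) 0 0 = z * (v *m w) 0 0.
  by rewrite vC -scalemxAl mxE.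
have e2 : C *m w = Num.conj z *: w.
  rewrite /w -{1}CC -trmx_mul -{1}realC -map_mxM vC.
  by apply/matrixP=> i j; rewrite !mxE rmorphM.
have /eqP : z * (v *m w) 0 0 = Num.conj z * (v *m w) 0 0.
  by rewrite -e1 -mulmxA e2 -scalemxAr mxE.
rewrite -subr_eq0 -mulrBl mulf_eq0 (negbTE nv) orbF subr_eq0 => /eqP zreal.
have zE : z = f (complex.Re z).
  by move: zreal; case: z {e1 e2 vC} => a b; simpc => -[/eqP]; rewrite -subr_eq0 opprK -mulr2n mulrn_eq0 /= => /eqP->.
have : eigenvalue C z by apply/eigenvalueP; exists v.
rewrite eigenvalue_root_char /C -map_char_poly zE fmorph_root.
rewrite -eigenvalue_root_char => /eigenvalueP[u uA u0].
by exists (complex.Re z), u.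
Qed.


Lemma row_norm_ge0 n (x : 'rV[R]_n) : 0 <= (x *m x^T) 0 0.
Proof. by rewrite mxE sumr_ge0// => i _; rewrite !mxE -expr2 sqr_ge0. Qed.

Lemma row_norm_gt0 n (x : 'rV[R]_n) : x != 0 -> 0 < (x *m x^T) 0 0.
Proof.
move=> x0; rewrite lt_neqAle row_norm_ge0 andbT eq_sym mxE.
rewrite psumr_eq0; last by move=> i _; rewrite !mxE -expr2 sqr_ge0.
apply: contra x0 => /allP h; apply/eqP/rowP=> i; rewrite mxE.
by have := h i (mem_index_enum _); rewrite /= !mxE mulf_eq0 orbb => /eqP.
Qed.

(** The reflection that exchanges v with the first basis vector. *)
Lemma householder_reflection n (v : 'rV[R]_n.+1) : (v *m v^T) 0 0 = 1 ->
  exists H : 'M[R]_n.+1, [/\ H^T = H, H *m H = 1%:M & row 0 H = v].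
Proof.
move=> nv; pose e : 'rV[R]_n.+1 := delta_mx 0 0; have [w wE] : exists w, w = v - e by exists (v - e).
have [w0|w0] := eqVneq w 0.
  exists 1%:M; rewrite trmx1 mulmx1; split => //.
  by rewrite row1; apply/esym/eqP; rewrite -subr_eq0 -wE; apply/eqP.
have ev : (e *m v^T) 0 0 = v 0 0 by rewrite -rowE !mxE.
have ve : (v *m e^T) 0 0 = v 0 0 by rewrite -[v *m _]trmxK trmx_mul trmxK mxE.
have ee : (e *m e^T) 0 0 = 1 by rewrite -rowE !mxE !eqxx.
have ew : (e *m w^T) 0 0 = v 0 0 - 1.
  by rewrite wE linearB /= mulmxBr mxE [X in _ + X]mxE ev ee.
have ww : (w *m w^T) 0 0 = 2 - 2 * v 0 0.
  rewrite {1}wE mulmxBl mxE [X in _ + X]mxE ew wE linearB /= mulmxBr mxE [X in _ + X - _]mxE nv ve.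
  by ring.
have wwn := row_norm_gt0 w0.
pose c := 2 / (w *m w^T) 0 0.
have cw : c * (w *m w^T) 0 0 = 2 by rewrite /c divfK ?gt_eqF.
exists (1%:M - c *: (w^T *m w)); split.
- by rewrite linearB /= linearZ /= trmx1 trmx_mul trmxK.
- have E : w^T *m w *m (w^T *m w) = (w *m w^T) 0 0 *: (w^T *m w).
    rewrite mulmxA -(mulmxA w^T) [X in w^T *m X](mx11_scalar (w *m w^T)).
    by rewrite mul_mx_scalar scalemxAl.
  rewrite mulmxBl mul1mx mulmxBr mulmx1 -scalemxAl -scalemxAr E.
  rewrite [c *: (c *: _)]scalerA [_ *: (_ *: _)]scalerA -mulrA cw -[RHS]subr0.
  rewrite -addrA; congr (_ + _).
  rewrite -scalerBl -opprD -scalerDl.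
  suff -> : c + (c - c * 2) = 0 by rewrite scale0r oppr0.
  by ring.
rewrite rowE -/e mulmxBr mulmx1 -scalemxAr mulmxA (mx11_scalar (e *m w^T)) ew.
rewrite mul_scalar_mx scalerA.
have -> : c * (v 0 0 - 1) = -1.
  have : (2 - 2 * v 0 0) != 0 by rewrite -ww gt_eqF.
  by rewrite /c ww => h; field.
by rewrite scaleN1r opprK wE addrC subrK.
Qed.

(** Deflation: conjugating by the reflection that maps a unit eigenvector to the
    first basis vector splits off a block of size one. *)
Lemma sym_spectral n (A : 'M[R]_n) : A^T = A ->
  exists (Q : 'M[R]_n) (d : 'rV[R]_n),
    Q *m Q^T = 1%:M /\ A = Q^T *m diag_mx d *m Q.
Proof.
elim: n A => [|n IH] A symA.
  by exists 1%:M, 0; split; apply/matrixP=> -[].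
have [a [v0 [v00 v0A]]] := sym_eigenvector symA.
pose r := Num.sqrt ((v0 *m v0^T) 0 0).
have r0 : r != 0 by rewrite gt_eqF// sqrtr_gt0 row_norm_gt0.
pose v := r^-1 *: v0.
have nv : (v *m v^T) 0 0 = 1.
  rewrite /v linearZ /= -scalemxAl -scalemxAr scalerA mxE.
  rewrite -(@sqr_sqrtr _ ((v0 *m v0^T) 0 0)) ?row_norm_ge0// -/r.
  by field.
have vA : v *m A = a *: v by rewrite /v -scalemxAl v0A !scalerA mulrC.
have [H [HT HH H0]] := householder_reflection nv.
(* An opaque name, so that [mxE] does not unfold the product. *)
have [B BH] : exists B : 'M[R]_(1 + n), B = H *m A *m H by exists (H *m A *m H).
have symB : B^T = B by rewrite BH !trmx_mul symA HT mulmxA.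
have B0 : row 0 B = a *: delta_mx 0 0.
  rewrite BH -mulmxA row_mul H0 mulmxA vA -scalemxAl; congr (_ *: _).
  by rewrite -H0 -row_mul HH row1.
have BE : B = block_mx a%:M 0 0 (drsubmx B).
  rewrite -{1}[B]submxK; congr block_mx.
  - rewrite [LHS]mx11_scalar; congr (_%:M); have /rowP/(_ 0) := B0.
    by rewrite !mxE !lshift0 eqxx mulr1.
  - apply/rowP=> j; have /rowP/(_ (rshift 1 j)) := B0.
    by rewrite !mxE lshift0 /= mulr0.
  - apply/colP=> j; have /rowP/(_ (rshift 1 j)) := B0.
    have Bs i k : B i k = B k i by rewrite -[in LHS]symB mxE.
    by rewrite !mxE !lshift0 Bs => ->; rewrite mulr0.
have symB' : (drsubmx B)^T = drsubmx B by rewrite trmx_drsub symB.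
have [Q [d [QQ B'E]]] := IH _ symB'.
pose K : 'M[R]_(1 + n) := block_mx 1%:M 0 0 Q.
have KK : K *m K^T = 1%:M.
  rewrite /K tr_block_mx mulmx_block !trmx0 !mulmx0 !mul0mx !addr0 !add0r trmx1.
  by rewrite mulmx1 QQ -scalar_mx_block.
exists (K *m H), (row_mx a%:M d); split.
  by rewrite trmx_mul mulmxA -(mulmxA K) HT HH mulmx1.
have -> : A = H *m B *m H by rewrite BH !mulmxA HH mul1mx -mulmxA HH mulmx1.
rewrite trmx_mul HT -!mulmxA; congr (H *m _); rewrite !mulmxA; congr (_ *m H).
rewrite BE B'E.
suff E : block_mx a%:M 0 0 (Q^T *m diag_mx d *m Q) =
    K^T *m diag_mx (row_mx (a%:M : 'rV_1) d) *m K by exact: E.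
rewrite diag_mx_row /K tr_block_mx !mulmx_block !trmx0 trmx1.
rewrite !(mulmx0, mul0mx, addr0, add0r, mulmx1, mul1mx).
by congr block_mx; rewrite [RHS]mx11_scalar !mxE eqxx.
Qed.


Lemma sym_sorted_spectral n (A : 'M[R]_n) : A^T = A ->
  exists (Q : 'M[R]_n) (d : 'rV[R]_n),
    [/\ Q *m Q^T = 1%:M, A = Q^T *m diag_mx d *m Q &
        forall i j : 'I_n, (i <= j)%N -> d 0 j <= d 0 i].
Proof.
move=> /sym_spectral[Q [d [QQ AE]]].
pose t := [tuple d 0 i | i < n].
have /tuple_permP[p pE] : perm_eq (sort >=%R t) t by rewrite perm_sort.
exists (row_perm p Q), (\row_i d 0 (p i)); split.
- rewrite row_permE trmx_mul mulmxA -(mulmxA _ Q) QQ mulmx1 tr_perm_mx.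
  by rewrite -perm_mxM mulgV perm_mx1.
- rewrite AE; apply/matrixP=> i j.
  rewrite !mul_mx_diag !mxE (reindex_inj (@perm_inj _ p)).
  by apply: eq_bigr => k _; rewrite !mxE.
move=> i j ij; rewrite !mxE.
have srt : sorted >=%R (sort >=%R t).
  by apply: sort_sorted => x y; rewrite /= le_total.
have rr : reflexive (>=%R : rel R) by move=> x /=.
have tr : transitive (>=%R : rel R) by move=> y x z /= yx zy; exact: le_trans zy yx.
have nthE (k : 'I_n) : nth 0 (sort >=%R t) k = d 0 (p k).
  by rewrite pE -tnth_nth !tnth_mktuple.
rewrite -!nthE; apply: (sorted_leq_nth tr rr 0 srt) => //;
  by rewrite inE size_sort size_tuple.
Qed.

Lemma char_poly_conj n (V W A : 'M[R]_n) : V *m W = 1%:M ->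
  char_poly (V *m A *m W) = char_poly A.
Proof.
move=> VW.
have E : char_poly_mx (V *m A *m W) =
    map_mx polyC V *m char_poly_mx A *m map_mx polyC W.
  rewrite /char_poly_mx !map_mxM /= mulmxBr mulmxBl; congr (_ - _).
  by rewrite mul_mx_scalar -scalemxAl -map_mxM VW map_mx1 scalemx1.
rewrite /char_poly E !det_mulmx mulrAC -det_mulmx -map_mxM VW map_mx1 det1.
by rewrite mul1r.
Qed.

Lemma eq_eigval n (A B : 'M[R]_n) : char_poly A = char_poly B ->
  eigval A =1 eigval B.
Proof. by rewrite /eigval /ordered_spectrum /is_ordered_spectrum => ->. Qed.

Lemma eigval_spectral n (A Q : 'M[R]_n) (d : 'rV[R]_n) :
  Q *m Q^T = 1%:M -> A = Q^T *m diag_mx d *m Q ->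
  (forall i j : 'I_n, (i <= j)%N -> d 0 j <= d 0 i) ->
  forall i, eigval A i = d 0 i.
Proof.
move=> QQ AE dle i.
have : is_ordered_spectrum A [tuple d 0 i | i < n].
  split.
    apply/(sortedP 0) => k; rewrite size_tuple => kn.
    have kn' : (k < n)%N by exact: ltn_trans kn.
    rewrite -[k]/(nat_of_ord (Ordinal kn')) -tnth_nth.
    rewrite -[X in nth _ _ X]/(nat_of_ord (Ordinal kn)) -tnth_nth.
    by rewrite !tnth_mktuple; exact: dle.
  rewrite AE char_poly_conj; last exact: mulmx1C.
  rewrite char_poly_trig; last exact/is_diag_mx_is_trig/diag_mx_is_diag.
  rewrite big_image /=; apply: eq_bigr => k _.
  by rewrite !mxE eqxx mulr1n.
move/ordered_spectrum_unique => -[E _].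
by rewrite /eigval E -tnth_nth tnth_mktuple.
Qed.

Lemma qform_spectral n (A Q : 'M[R]_n) (d : 'rV[R]_n) (x : 'rV_n) :
  A = Q^T *m diag_mx d *m Q ->
  qform A x = \sum_k d 0 k * (x *m Q^T) 0 k ^+ 2.
Proof.
move=> ->; rewrite /qform.
have -> : x *m (Q^T *m diag_mx d *m Q) *m x^T =
    (x *m Q^T) *m diag_mx d *m (x *m Q^T)^T.
  by rewrite trmx_mul trmxK !mulmxA.
rewrite mxE; apply: eq_bigr => k _; rewrite mul_mx_diag !mxE; ring.
Qed.

Lemma row_norm_orthogonal n (Q : 'M[R]_n) (x : 'rV_n) : Q *m Q^T = 1%:M ->
  (x *m x^T) 0 0 = \sum_k (x *m Q^T) 0 k ^+ 2.
Proof.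
move=> /mulmx1C QQ.
have -> : x *m x^T = (x *m Q^T) *m (x *m Q^T)^T.
  by rewrite trmx_mul trmxK mulmxA -(mulmxA x) QQ mulmx1.
by rewrite mxE; apply: eq_bigr => k _; rewrite !mxE expr2.
Qed.

(** Some nonzero vector x is orthogonal to the eigenvectors of A of index greater
    than i and to those of B of index less than i, since these are only n - 1
    conditions. The form of A at x is then at least its i-th eigenvalue times
    the squared norm of x, and the form of B at most its i-th eigenvalue times
    the same. *)
Lemma eigval_le_of_qform n (A B : 'M[R]_n) (e : R) : A^T = A -> B^T = B ->
  (forall x : 'rV_n, qform A x <= qform B x + e * (x *m x^T) 0 0) ->
  forall i, eigval A i <= eigval B i + e.
Proof.
move=> /sym_sorted_spectral[Q [d [QQ AE dle]]].
move=> /sym_sorted_spectral[Q' [d' [QQ' BE dle']]] AB i.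
rewrite (eigval_spectral QQ AE dle) (eigval_spectral QQ' BE dle').
pose M : 'M[R]_n := \matrix_(r, k)
  if (k < i)%N then Q' k r else if (i < k)%N then Q k r else 0.
(* Column i of M is zero: no condition is imposed there. *)
have detM : \det M = 0.
  rewrite -det_tr; apply/eqP/det0P; exists (delta_mx 0 i).
    by apply/eqP => /rowP/(_ i); rewrite !mxE !eqxx => /eqP; rewrite oner_eq0.
  by rewrite -rowE; apply/rowP => k; rewrite !mxE ltnn.
have /det0P[x x0 xM] : \det M == 0 by rewrite detM.
have x1 (k : 'I_n) : (k < i)%N -> (x *m Q'^T) 0 k = 0.
  move=> ki; have /rowP/(_ k) := xM; rewrite !mxE => {2}<-.
  by apply: eq_bigr => j _; rewrite !mxE ki.
have x2 (k : 'I_n) : (i < k)%N -> (x *m Q^T) 0 k = 0.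
  move=> ki; have /rowP/(_ k) := xM; rewrite !mxE => {2}<-.
  by apply: eq_bigr => j _; rewrite !mxE ki ltnNge (ltnW ki).
have h1 : d 0 i * (x *m x^T) 0 0 <= qform A x.
  rewrite (qform_spectral _ AE) (row_norm_orthogonal x QQ) mulr_sumr ler_sum// => k _.
  have [ki|ki] := leqP k i; first by rewrite ler_wpM2r ?sqr_ge0 ?dle.
  by rewrite x2// expr0n /= !mulr0.
have h2 : qform B x <= d' 0 i * (x *m x^T) 0 0.
  rewrite (qform_spectral _ BE) (row_norm_orthogonal x QQ') mulr_sumr ler_sum// => k _.
  have [ki|ki] := leqP i k; first by rewrite ler_wpM2r ?sqr_ge0 ?dle'.
  by rewrite x1// expr0n /= !mulr0.
rewrite -(ler_pM2r (row_norm_gt0 x0)) (le_trans h1)// (le_trans (AB x))//.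
by rewrite mulrDl lerD2r.
Qed.

Lemma weyl_inequality n (A B : 'M[R]_n) (e : R) : A^T = A -> B^T = B ->
  (forall x : 'rV_n, `|qform (A - B) x| <= e * (x *m x^T) 0 0) ->
  forall i, `|eigval A i - eigval B i| <= e.
Proof.
move=> symA symB AB i.
have qB x : qform (A - B) x = qform A x - qform B x.
  by rewrite /qform mulmxBr mulmxBl mxE [X in _ + X]mxE.
rewrite ler_distl lerBlDr; apply/andP; split; apply: eigval_le_of_qform => // x;
  have := AB x; rewrite qB ler_norml => /andP[h1 h2]; lra.
Qed.

(** The square roots of the eigenvalues, in the same orthonormal basis. *)
Lemma mxsqrtP n (A : 'M[R]_n) : sym_posdef A ->
  sym_posdef (mxsqrt A) /\ mxsqrt A *m mxsqrt A = A.
Proof.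
move=> [symA posA].
rewrite /mxsqrt; case: xgetP => [B _ []//|/=].
have [Q [d [QQ AE]]] := sym_spectral symA.
have Qu : forall x : 'rV_n, x *m Q^T = 0 -> x = 0.
  by move=> x xQ; rewrite -(mulmx1 x) -(mulmx1C QQ) mulmxA xQ mul0mx.
have d0 k : 0 < d 0 k.
  pose x : 'rV_n := delta_mx 0 k *m Q.
  have x0 : x^T != 0.
    rewrite -trmx0 (inj_eq trmx_inj); apply/eqP => xz.
    have : x *m Q^T = 0 by rewrite xz mul0mx.
    rewrite /x -mulmxA QQ mulmx1 => /rowP/(_ k); rewrite !mxE !eqxx => /eqP.
    by rewrite oner_eq0.
  have := posA _ x0; rewrite trmxK -/(qform A x) (qform_spectral _ AE).
  rewrite /x -mulmxA QQ mulmx1 (bigD1 k)//= big1 ?addr0.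
    by rewrite mxE !eqxx expr1n mulr1.
  by move=> j jk; rewrite !mxE (negbTE jk) andbF expr0n mulr0.
pose B := Q^T *m diag_mx (\row_k Num.sqrt (d 0 k)) *m Q.
move=> /(_ B); case; split; last first.
  rewrite /B !mulmxA -(mulmxA _ Q) QQ mulmx1 -(mulmxA Q^T) mulmx_diag AE.
  congr (_ *m diag_mx _ *m _); apply/rowP => k; rewrite !mxE -expr2.
  by rewrite sqr_sqrtr// ltW.
split; first by rewrite /B !trmx_mul trmxK tr_diag_mx mulmxA.
move=> x x0; pose y := x^T.
have -> : x = y^T by rewrite trmxK.
rewrite trmxK -/(qform B y) (qform_spectral y (erefl B)).
have h k : 0 <= (\row_k0 Num.sqrt (d 0 k0)) 0 k * (y *m Q^T) 0 k ^+ 2.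
  by rewrite mulr_ge0 ?sqr_ge0// mxE sqrtr_ge0.
rewrite lt_neqAle sumr_ge0// andbT eq_sym psumr_eq0//.
apply: contra x0 => /allP h0; rewrite -[x]trmxK -/y.
rewrite -[0]trmx0 (inj_eq trmx_inj); apply/eqP/Qu/rowP => k.
have := h0 k (mem_index_enum _); rewrite /= mulf_eq0 sqrf_eq0 mxE.
by rewrite gt_eqF ?sqrtr_gt0//= => /eqP ->; rewrite mxE.
Qed.


(** The supremum that defines the spectral norm is finite, and the unit
    eigenvectors show that it is at least the modulus of every eigenvalue. *)
Lemma qform_spectral_norm n (A : 'M[R]_n) (x : 'rV_n) :
  A^T = A -> qform A x <= spectral_norm A * (x *m x^T) 0 0.
Proof.
move=> symA; have [Q [d [QQ AE]]] := sym_spectral symA.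
have AAE : A *m A = Q^T *m diag_mx (\row_k d 0 k ^+ 2) *m Q.
  rewrite AE !mulmxA -(mulmxA _ Q) QQ mulmx1 -(mulmxA Q^T) mulmx_diag.
  by congr (_ *m diag_mx _ *m _); apply/rowP => k; rewrite !mxE expr2.
have enE (y : 'rV[R]_n) :
    euclidean_norm (A *m y^T) = Num.sqrt (\sum_k d 0 k ^+ 2 * (y *m Q^T) 0 k ^+ 2).
  congr (Num.sqrt _).
  transitivity (qform (A *m A) y).
    have -> : qform (A *m A) y = ((A *m y^T)^T *m (A *m y^T)) 0 0.
      by rewrite /qform trmx_mul trmxK symA !mulmxA.
    by rewrite mxE; apply: eq_bigr => k _; rewrite !mxE expr2.
  by rewrite (qform_spectral _ AAE); apply: eq_bigr => k _; rewrite mxE.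
have en1 (y : 'rV[R]_n) : euclidean_norm y^T = Num.sqrt ((y *m y^T) 0 0).
  by congr (Num.sqrt _); rewrite mxE; apply: eq_bigr => k _; rewrite !mxE expr2.
have ubA : has_ubound [set euclidean_norm (A *m y) | y in [set y | euclidean_norm y <= 1]].
  exists (Num.sqrt (\sum_k d 0 k ^+ 2)) => _ [y y1 <-].
  rewrite -(trmxK y) enE ler_wsqrtr// ler_sum// => k _.
  rewrite ler_piMr ?sqr_ge0//.
  have : (y^T *m y^T^T) 0 0 <= 1.
    rewrite -(@sqr_sqrtr _ ((y^T *m y^T^T) 0 0)) ?row_norm_ge0// -en1 trmxK.
    by rewrite expr_le1// sqrtr_ge0.
  apply: le_trans; rewrite (row_norm_orthogonal _ QQ) (bigD1 k)//= lerDl sumr_ge0// => j _.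
  exact: sqr_ge0.
rewrite (qform_spectral _ AE) (row_norm_orthogonal x QQ) mulr_sumr ler_sum// => k _.
rewrite ler_wpM2r ?sqr_ge0//.
pose y : 'rV[R]_n := delta_mx 0 k *m Q.
have yQ j : (y *m Q^T) 0 j = (j == k)%:R.
  by rewrite /y -mulmxA QQ mulmx1 mxE eqxx.
apply: (@le_trans _ _ (euclidean_norm (A *m y^T))).
  rewrite enE (bigD1 k)//= big1 ?addr0; last first.
    by move=> j jk; rewrite yQ (negbTE jk) expr0n mulr0.
  by rewrite yQ eqxx expr1n mulr1 sqrtr_sqr ler_norm.
apply: ub_le_sup => //; exists y^T => //=.
rewrite en1 (row_norm_orthogonal _ QQ) (bigD1 k)//= big1 ?addr0; last first.
  by move=> j jk; rewrite yQ (negbTE jk) expr0n.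
by rewrite yQ eqxx expr1n sqrtr1.
Qed.

Lemma trace_power n (F Q : 'M[R]_n) (d : 'rV[R]_n) (k : nat) :
  Q *m Q^T = 1%:M -> F = Q^T *m diag_mx d *m Q ->
  \tr (F ^+ k) = \sum_j d 0 j ^+ k.
Proof.
move=> QQ FE.
have -> : F ^+ k = Q^T *m diag_mx (\row_j d 0 j ^+ k) *m Q.
  elim: k => [|k IH].
    rewrite expr0 -[1]/(1%:M) -(mulmx1C QQ); congr (_ *m _).
    rewrite -[LHS]mulmx1; congr (_ *m _).
    by apply/matrixP => i j; rewrite !mxE.
  rewrite exprS IH -[_ * _]/(_ *m _) {1}FE.
  rewrite !mulmxA -(mulmxA _ Q) QQ mulmx1 -(mulmxA Q^T) mulmx_diag.
  by congr (_ *m diag_mx _ *m _); apply/rowP => j; rewrite !mxE exprS.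
rewrite mxtrace_mulC mulmxA QQ mul1mx mxtrace_diag.
by apply: eq_bigr => j _; rewrite mxE.
Qed.

Lemma trace_even_power_ge0 n (F : 'M[R]_n) (K : nat) :
  F^T = F -> ~~ odd K -> 0 <= \tr (F ^+ K).
Proof.
move=> /sym_spectral[Q [d [QQ FE]]] evK.
by rewrite (trace_power K QQ FE) sumr_ge0// => j _; rewrite exprn_even_ge0.
Qed.

(** For K even, the K-th power of each eigenvalue is at most the sum of all these
    powers, which is the trace. *)
Lemma qform_trace_bound n (F : 'M[R]_n) (K : nat) (t : R) (x : 'rV_n) :
  F^T = F -> (0 < K)%N -> ~~ odd K -> 0 <= t -> \tr (F ^+ K) <= t ^+ K ->
  `|qform F x| <= t * (x *m x^T) 0 0.
Proof.
move=> symF K0 evK t0 tr; have [Q [d [QQ FE]]] := sym_spectral symF.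
have dk k : `|d 0 k| <= t.
  rewrite -(@ler_pXn2r _ K)// ?nnegrE// (le_trans _ tr)//.
  rewrite (trace_power K QQ FE) (bigD1 k)//=.
  rewrite -normrX ger0_norm ?exprn_even_ge0// lerDl sumr_ge0// => j _.
  by rewrite exprn_even_ge0.
rewrite (qform_spectral _ FE) (row_norm_orthogonal x QQ) (le_trans (ler_norm_sum _ _ _))//.
rewrite mulr_sumr ler_sum// => k _.
by rewrite normrM [X in _ * X]ger0_norm ?sqr_ge0// ler_wpM2r ?sqr_ge0.
Qed.

Lemma qform_entry_bound n (F : 'M[R]_n) (x : 'rV_n) :
  `|qform F x| <= (\sum_i \sum_j `|F i j|) * (x *m x^T) 0 0.
Proof.
have nE : (x *m x^T) 0 0 = \sum_k x 0 k ^+ 2.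
  by rewrite mxE; apply: eq_bigr => k _; rewrite !mxE expr2.
have xk k : `|x 0 k| ^+ 2 <= (x *m x^T) 0 0.
  rewrite nE (bigD1 k)//= real_normK ?num_real// lerDl sumr_ge0// => j _.
  exact: sqr_ge0.
have -> : qform F x = \sum_i \sum_j x 0 j * F j i * x 0 i.
  by rewrite /qform mxE; apply: eq_bigr => i _; rewrite !mxE mulr_suml.
rewrite exchange_big/= (le_trans (ler_norm_sum _ _ _))// mulr_suml.
rewrite ler_sum// => i _; rewrite (le_trans (ler_norm_sum _ _ _))// mulr_suml.
rewrite ler_sum// => j _; rewrite !normrM mulrAC mulrC ler_wpM2l//.
have := sqr_ge0 (`|x 0 i| - `|x 0 j|); have := xk i; have := xk j.
by rewrite sqrrB; lra.
Qed.

Lemma posdef_unit n (A : 'M[R]_n) : sym_posdef A -> A \in unitmx.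
Proof.
move=> [symA posA]; rewrite unitmxE unitfE; apply/negP => /det0P[x x0 xA].
have xT0 : x^T != 0 by rewrite -trmx0 (inj_eq trmx_inj).
by have := posA _ xT0; rewrite trmxK xA mul0mx mxE ltxx.
Qed.

Section sandwich.
Context (n : nat) (A : 'M[R]_n) (M : R).
Hypotheses (posA : sym_posdef A) (AM : spectral_norm A <= M).
Let s := mxsqrt A.

Lemma eigval_sandwich_lip (S S' : 'M[R]_n) (t : R) : S^T = S -> S'^T = S' -> 0 <= t ->
  (forall x : 'rV_n, `|qform (S - S') x| <= t * (x *m x^T) 0 0) ->
  forall i, `|eigval (s *m S *m s) i - eigval (s *m S' *m s) i| <= M * t.
Proof.
move=> symS symS' t0 SS'; have [[syms _] ss] := mxsqrtP posA.
apply: weyl_inequality; rewrite ?trmx_mul ?syms ?symS ?symS' ?mulmxA// => x.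
have -> : qform (s *m S *m s - s *m S' *m s) x = qform (S - S') (x *m s).
  by rewrite /qform trmx_mul syms !(mulmxBr, mulmxBl) !mulmxA.
rewrite (le_trans (SS' _))// trmx_mul syms.
have -> : x *m s *m (s *m x^T) = x *m A *m x^T by rewrite !mulmxA -(mulmxA x s) [s *m s]ss.
rewrite [M * t]mulrC -mulrA ler_wpM2l// (le_trans (qform_spectral_norm x posA.1))//.
by rewrite ler_wpM2r ?row_norm_ge0.
Qed.

(** The two matrices are conjugate through the square root of A. *)
Lemma eigval_mul_posdef (D : 'M[R]_n) : eigval (D *m A) =1 eigval (s *m D *m s).
Proof.
have [ps ss] := mxsqrtP posA; apply: eq_eigval.
have us := posdef_unit ps.
rewrite -(@char_poly_conj n s (invmx s)) ?mulmxV//.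
by rewrite -ss -/s !mulmxA mulmxK.
Qed.

Lemma mxdiag_part_sym (S : 'M[R]_n) : (mxdiag_part S)^T = mxdiag_part S.
Proof. exact: tr_diag_mx. Qed.

(** The form of the difference of the two sandwiched matrices at x is the form
    of the off-diagonal part of S at x s, and the squared norm of x s is the form
    of A at x. *)
Lemma eigval_diag_trace_bound (S : 'M[R]_n) (K : nat) (t : R) : S^T = S ->
  (0 < K)%N -> ~~ odd K -> 0 <= t ->
  \tr ((S - mxdiag_part S) ^+ K) <= t ^+ K ->
  forall i, `|eigval (s *m S *m s) i - eigval (mxdiag_part S *m A) i| <= M * t.
Proof.
move=> symS K0 evK t0 tr i; rewrite eigval_mul_posdef.
apply: eigval_sandwich_lip; rewrite ?mxdiag_part_sym// => x.
by apply: qform_trace_bound K0 evK t0 tr; rewrite linearB /= symS mxdiag_part_sym.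
Qed.

Lemma eigval_sandwich_entry (S S' : 'M[R]_n) : S^T = S -> S'^T = S' -> forall i,
  `|eigval (s *m S *m s) i - eigval (s *m S' *m s) i| <=
  M * \sum_i \sum_j `|S i j - S' i j|.
Proof.
move=> symS symS' i; apply: eigval_sandwich_lip => // [|x].
  by rewrite sumr_ge0// => k _; rewrite sumr_ge0.
rewrite (le_trans (qform_entry_bound _ _))// ler_wpM2r ?row_norm_ge0//.
by rewrite ler_sum// => k _; rewrite ler_sum// => l _; rewrite !mxE.
Qed.

End sandwich.

End linear_algebra.

(** * Measurability of the eigenvalue gap *)

Section superlevel_sets.
Context {d : measure_display} {T : measurableType d} {R : realType}.
Variables (f : T -> R) (c : R).
Hypothesis mf : measurable_fun setT f.

Lemma measurable_superlevel : measurable [set w | c < f w].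
Proof.
have := @mf measurableT `]c, +oo[%classic (measurable_itv _).
by rewrite setTI; congr measurable; apply/seteqP; split => w /=; rewrite in_itv /= andbT.
Qed.

Lemma measurable_superlevel_large : measurable [set w | c <= f w].
Proof.
have := @mf measurableT `[c, +oo[%classic (measurable_itv _).
by rewrite setTI; congr measurable; apply/seteqP; split => w /=; rewrite in_itv /= andbT.
Qed.

End superlevel_sets.

Lemma measurable_abs {d : measure_display} {T : measurableType d} {R : realType}
    (f : T -> R) :
  measurable_fun setT f -> measurable_fun setT (fun w => `|f w|).
Proof. by move=> mf; apply: measurableT_comp => //; exact: normr_measurable. Qed.

Section lipschitz.
Context {d : measure_display} {T : measurableType d} {R : realType}.

Definition entry_dist n (A B : 'M[R]_n) : R := \sum_i \sum_j `|A i j - B i j|.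

Lemma rat_matrix_approx n (A : 'M[R]_n) (e : R) : 0 < e ->
  exists C : 'M[rat]_n, entry_dist A (map_mx ratr C) <= (n * n)%:R * e.
Proof.
move=> e0.
have h i j : exists q : rat, `|A i j - ratr q| <= e.
  have /rat_in_itvoo[q] : A i j < A i j + e by rewrite ltrDl.
  rewrite in_itv /= => /andP[q1 q2]; exists q.
  by rewrite distrC ger0_norm ?subr_ge0 ?(ltW q1)// lerBlDl ltW.
have /choice[g gP] : forall ij : 'I_n * 'I_n, exists q : rat,
  `|A ij.1 ij.2 - ratr q| <= e by move=> ij; exact: h.
exists (\matrix_(i, j) g (i, j)).
apply: (@le_trans _ _ (\sum_(i < n) \sum_(j < n) e)).
  by apply: ler_sum => i _; apply: ler_sum => j _; rewrite !mxE; exact: (gP (i, j)).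
by rewrite !sumr_const !card_ord -mulrnA mulr_natl.
Qed.

(** A function f that is Lipschitz for [entry_dist] is the infimum, over the
    countably many rational matrices C, of f(C) + M dist(S, C), and each of these
    functions is measurable because the entries of S are. *)
Lemma measurable_lipschitz n (f : 'M[R]_n -> R) (M : R) (S : T -> 'M[R]_n) :
  0 <= M -> (forall A B, `|f A - f B| <= M * entry_dist A B) ->
  (forall i j, measurable_fun setT (fun w => S w i j)) ->
  measurable_fun setT (fun w => f (S w)).
Proof.
move=> M0 fL mS; apply: (measurability _ (RGenInftyO.measurableE R)) => //.
move=> /= _ [_ [c ->] <-]; rewrite setTI.
pose g (C : 'M[rat]_n) w := f (map_mx ratr C) + M * entry_dist (S w) (map_mx ratr C).
have mg C : measurable_fun setT (g C).
  apply: measurable_funD => //; apply: measurable_funM => //.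
  apply: measurable_sum => i; apply: measurable_sum => j.
  exact/measurable_abs/measurable_funB.
pose F (k : nat) : set T := if unpickle k is Some C then [set w | g C w < c] else set0.
have -> : (fun w => f (S w)) @^-1` `]-oo, c[ = \bigcup_k F k.
  apply/seteqP; split=> w /=.
    rewrite in_itv /= => fc.
    pose e := (c - f (S w)) / (2 * M * (n * n)%:R + 1).
    have den : 0 < 2 * M * (n * n)%:R + 1.
      by rewrite ltr_wpDl// mulr_ge0// mulr_ge0.
    have e0 : 0 < e by rewrite divr_gt0// subr_gt0.
    have [C CP] := rat_matrix_approx (S w) e0.
    exists (pickle C) => //; rewrite /F pickleK /= /g.
    have := fL (S w) (map_mx ratr C); rewrite ler_norml => /andP[h1 h2].
    have h3 : M * entry_dist (S w) (map_mx ratr C) <= M * ((n * n)%:R * e).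
      by rewrite ler_wpM2l.
    have h4 : e * (2 * M * (n * n)%:R + 1) = c - f (S w) by rewrite /e divfK// gt_eqF.
    by lra.
  move=> [k _]; rewrite /F; case: unpickle => // C /=; rewrite /g in_itv /= => gc.
  have := fL (S w) (map_mx ratr C); rewrite ler_norml => /andP[h1 h2].
  by lra.
apply: bigcupT_measurable => k; rewrite /F; case: unpickle => // C.
have := mg C measurableT `]-oo, c[%classic (measurable_itv _).
by rewrite setTI; congr measurable; apply/seteqP; split=> w /=; rewrite in_itv.
Qed.

End lipschitz.

Section eigenvalue_gap.
Context {R : realType} (n : nat) (A : 'M[R]_n) (M : R).
Hypotheses (posA : sym_posdef A) (AM : spectral_norm A <= M).
Let s := mxsqrt A.

Definition eigval_gap (S : 'M[R]_n) : R :=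
  \big[Num.max/0]_(i < n) `|eigval (s *m S *m s) i - eigval (mxdiag_part S *m A) i|.

Lemma eigval_gap_ge0 S : 0 <= eigval_gap S.
Proof. by rewrite /eigval_gap; elim/big_ind: _ => // x y x0 y0; rewrite le_max x0. Qed.

Lemma eigval_gap_le S (t : R) : 0 <= t ->
  (forall i, `|eigval (s *m S *m s) i - eigval (mxdiag_part S *m A) i| <= t) ->
  eigval_gap S <= t.
Proof.
move=> t0 h; rewrite /eigval_gap; elim/big_ind: _ => // x y xt yt.
by rewrite ge_max xt yt.
Qed.

(** Rational approximations of a symmetric matrix need not be symmetric, so the
    eigenvalues of A^(1/2) S A^(1/2) are first extended to all matrices by
    replacing S with its symmetric part, which preserves the Lipschitz bound. *)
Lemma measurable_eigval_gap d (T : measurableType d) (S : T -> 'M[R]_n) :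
  0 <= M -> (forall w, (S w)^T = S w) ->
  (forall i j, measurable_fun setT (fun w => S w i j)) ->
  measurable_fun setT (fun w => eigval_gap (S w)).
Proof.
move=> M0 symS mS; rewrite /eigval_gap.
pose sym (B : 'M[R]_n) := 2^-1 *: (B + B^T).
have symsym B : (sym B)^T = sym B.
  by rewrite /sym linearZ /= linearD /= trmxK addrC.
have symSE w : sym (S w) = S w.
  by rewrite /sym symS; apply/matrixP => i j; rewrite !mxE; field.
have sym_dist B B' : entry_dist (sym B) (sym B') <= entry_dist B B'.
  have E : entry_dist B B' = 2^-1 * (entry_dist B B' + entry_dist B^T B'^T).
    have -> : entry_dist B^T B'^T = entry_dist B B'.
      rewrite /entry_dist exchange_big; apply: eq_bigr => i _; apply: eq_bigr => j _.
      by rewrite !mxE.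
    by field.
  rewrite E /entry_dist -big_split /= mulr_sumr; apply: ler_sum => i _.
  rewrite -big_split /= mulr_sumr; apply: ler_sum => j _; rewrite !mxE.
  rewrite -mulrBr normrM ger0_norm ?invr_ge0// ler_wpM2l ?invr_ge0//.
  by rewrite opprD addrACA ler_normD.
have diag_dist (B B' : 'M[R]_n) : entry_dist (mxdiag_part B) (mxdiag_part B') <= entry_dist B B'.
  apply: ler_sum => i _; apply: ler_sum => j _; rewrite !mxE.
  by case: eqP => [->|_]; rewrite ?mulr1n// !mulr0n subrr normr0.
have m1 i : measurable_fun setT (fun w => eigval (s *m S w *m s) i).
  have h := @measurable_lipschitz _ T R n (fun B => eigval (s *m sym B *m s) i) M S M0.
  under eq_fun => w do rewrite -symSE.
  apply: h => // B B'; apply: le_trans (eigval_sandwich_entry posA AM _ _ _) _ => //.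
  exact: ler_wpM2l (sym_dist B B').
have m2 i : measurable_fun setT (fun w => eigval (mxdiag_part (S w) *m A) i).
  apply: (@measurable_lipschitz _ T R n (fun B => eigval (mxdiag_part B *m A) i) M S M0) => // B B'.
  rewrite !(eigval_mul_posdef posA).
  apply: le_trans (eigval_sandwich_entry posA AM _ _ _) _; rewrite ?mxdiag_part_sym//.
  exact: ler_wpM2l (diag_dist B B').
elim: (index_enum _) => [|i r IH].
  by under eq_fun do rewrite big_nil; exact: measurable_cst.
under eq_fun do rewrite big_cons.
apply: measurable_maxr => //; apply: measurableT_comp; first exact: normr_measurable.
exact: measurable_funB.
Qed.

End eigenvalue_gap.

(** * Walks between rows and columns *)

Section walks.
Context {V W : eqType}.
Implicit Types (i : V) (s : seq (W * V)).

(** A walk that starts in row i is encoded by the list of its pairs (column, next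
    row). Each pair crosses two cells, one in the old row and one in the new. *)
Fixpoint edges i s : seq (V * W) :=
  if s is x :: s' then (i, x.1) :: (x.2, x.1) :: edges x.2 s' else [::].

Fixpoint moving i s : bool :=
  if s is x :: s' then (i != x.2) && moving x.2 s' else true.

Definition rows i s : seq V := i :: map snd s.
Definition cols s : seq W := map fst s.

Lemma rows_cons i x s : rows i (x :: s) = i :: rows x.2 s. Proof. by []. Qed.

Lemma cols_cons x s : cols (x :: s) = x.1 :: cols s. Proof. by []. Qed.

Definition ndistinct (U : eqType) (r : seq U) : nat := size (undup r).

Lemma ndistinct_cons (U : eqType) (x : U) (r : seq U) :
  ndistinct (x :: r) = ((x \notin r) + ndistinct r)%N.
Proof. by rewrite /ndistinct /=; case: ifP => //= _; rewrite add1n. Qed.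

Lemma size_edges i s : size (edges i s) = (size s).*2.
Proof. by elim: s i => //= x s IH i; rewrite IH. Qed.

Lemma edges_rows i s e : e \in edges i s -> e.1 \in rows i s.
Proof.
elim: s i => //= x s IH i; rewrite !inE => /or3P[/eqP->|/eqP->|/IH] /=;
  by rewrite ?inE ?eqxx ?orbT// => ->; rewrite orbT.
Qed.

Lemma edges_cols i s e : e \in edges i s -> e.2 \in cols s.
Proof.
elim: s i => //= x s IH i; rewrite !inE => /or3P[/eqP->|/eqP->|/IH] /=;
  by rewrite ?eqxx// => ->; rewrite orbT.
Qed.

(** A new starting row makes its first cell new. A new column makes both of its
    cells new, and they are distinct because the walk changes rows. *)
Lemma ndistinct_edges_step i x s : i != x.2 ->
  ((i \notin rows x.2 s) + (x.1 \notin cols s) + ndistinct (edges x.2 s)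
    <= ndistinct (edges i (x :: s)))%N /\
  ((x.1 \notin cols s).*2 + ndistinct (edges x.2 s)
    <= ndistinct (edges i (x :: s)))%N.
Proof.
move=> ix; rewrite /= !ndistinct_cons.
have hi : ((i \notin rows x.2 s) <= ((i, x.1) \notin (x.2, x.1) :: edges x.2 s))%N.
  case: (boolP (i \notin _)) => // h; rewrite inE negb_or.
  rewrite (contra (@edges_rows _ _ (i, x.1)) h) andbT lt0b.
  by apply: contra ix => /eqP[->].
have hc : ((x.1 \notin cols s) <= ((x.2, x.1) \notin edges x.2 s))%N.
  by case: (boolP (x.1 \notin _)) => // h; rewrite (contra (@edges_cols _ _ (x.2, x.1)) h).
have hc' : ((x.1 \notin cols s) <= ((i, x.1) \notin (x.2, x.1) :: edges x.2 s))%N.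
  case: (boolP (x.1 \notin _)) => // h; rewrite inE negb_or.
  rewrite (contra (@edges_cols _ _ (i, x.1)) h) andbT lt0b.
  by apply: contra ix => /eqP[->].
by rewrite -!addnn !addnA; split; rewrite leq_add2r leq_add.
Qed.

(** The graph of a walk is connected, so it has at most one vertex more than it has
    edges. *)
Lemma walk_connected i s : moving i s ->
  (ndistinct (rows i s) + ndistinct (cols s) <= (ndistinct (edges i s)).+1)%N.
Proof.
elim: s i => // x s IH i /andP[ix /IH{}IH].
have [h _] := ndistinct_edges_step s ix.
rewrite rows_cons cols_cons (ndistinct_cons i) (ndistinct_cons x.1).
move: h IH; move: (ndistinct (edges i _)) (ndistinct (edges _ _)) => E E'.
move: (nat_of_bool (i \notin _)) (nat_of_bool (x.1 \notin _)) => b1 b2. lia.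
Qed.

(** Every column is entered and left through two different cells. *)
Lemma walk_degree i s : moving i s ->
  ((ndistinct (cols s)).*2 <= ndistinct (edges i s))%N.
Proof.
elim: s i => // x s IH i /andP[ix /IH{}IH].
have [_ h] := ndistinct_edges_step s ix.
rewrite cols_cons (ndistinct_cons x.1).
move: h IH; move: (ndistinct (edges i _)) (ndistinct (edges _ _)) => E E'.
move: (nat_of_bool (x.1 \notin _)) => b2; lia.
Qed.

End walks.

Section expansion.
Context {R : realType}.

Fixpoint words (U : Type) (r : seq U) (K : nat) : seq (seq U) :=
  if K is K'.+1 then [seq x :: s | x <- r, s <- words r K'] else [:: [::]].

Lemma size_words (U : eqType) (r : seq U) K s : s \in words r K -> size s = K.
Proof.
by elim: K s => [|K IH] s /=; [rewrite inE => /eqP->|case/allpairsP => -[x t] /= [_ /IH <- ->]].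
Qed.

Lemma big_words_cons (U : finType) K (f : seq U -> R) :
  \sum_(s <- words (index_enum U) K.+1) f s =
  \sum_x \sum_(s <- words (index_enum U) K) f (x :: s).
Proof. by rewrite /= big_allpairs_dep. Qed.

(** Only walks that change rows at every step occur, because the diagonal has been
    removed. *)
Lemma offdiag_power p n (X : 'M[R]_(p, n)) K i j :
  ((X *m X^T - mxdiag_part (X *m X^T)) ^+ K) i j =
  \sum_(s <- words (index_enum ('I_n * 'I_p)%type) K)
    (moving i s && (last i (map snd s) == j))%:R *
    \prod_(e <- edges i s) X e.1 e.2.
Proof.
set F := X *m X^T - _.
have FE a b : F a b = \sum_t (a != b)%:R * (X a t * X b t).
  rewrite /F !mxE; have [<-|ab] := eqVneq a b.
    by rewrite mulr1n subrr big1// => t _; rewrite mul0r.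
  by rewrite mulr0n subr0; apply: eq_bigr => t _; rewrite mxE mul1r.
elim: K i => [|K IH] i.
  rewrite /= big_seq1 big_nil mulr1 /= expr0.
  by rewrite -[1]/(1%:M) mxE.
rewrite exprS -[_ * _]/(_ *m _) mxE big_words_cons.
transitivity (\sum_l \sum_t \sum_(s <- words (index_enum ('I_n * 'I_p)%type) K)
    (moving i ((t, l) :: s) && (last i (map snd ((t, l) :: s)) == j))%:R *
    \prod_(e <- edges i ((t, l) :: s)) X e.1 e.2); last first.
  by rewrite exchange_big /= pair_big; apply: eq_bigr => -[t l] _.
apply: eq_bigr => l _; rewrite FE IH mulr_suml; apply: eq_bigr => t _.
rewrite mulr_sumr; apply: eq_bigr => s _.
rewrite /= !big_cons /= -andbA -[in RHS]mulnb natrM; ring.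
Qed.

(** The letters already in r are at most as many as its size and change nothing;
    all the others together carry the weight #|U| c <= 1. *)
Lemma sum_new_letter (U : finType) (r : seq U) (c : R) :
  #|U|%:R * c <= 1 -> 0 <= c ->
  \sum_(x : U) c ^+ ndistinct (x :: r) <= (size r).+1%:R * c ^+ ndistinct r.
Proof.
move=> cU c0.
apply: (@le_trans _ _ (\sum_x ((x \in r)%:R * c ^+ ndistinct r + c * c ^+ ndistinct r))).
  apply: ler_sum => x _; rewrite ndistinct_cons.
  case: (x \in r) => /=; rewrite ?add0n ?add1n ?mul1r ?mul0r ?add0r ?exprS//.
  by rewrite lerDl mulr_ge0// exprn_ge0.
rewrite big_split /= -mulr_suml sumr_const -[X in _ + X]mulr_natl mulrA.
rewrite -natr1 mulrDl mul1r lerD//; last first.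
  by rewrite ler_piMl// exprn_ge0.
rewrite ler_wpM2r ?exprn_ge0// -natr_sum ler_nat.
apply: leq_trans (card_size r); rewrite -sum1_card [leqRHS]big_mkcond /=.
by apply: leq_sum => x _; case: ifP.
Qed.

Lemma sum_words_weights (W V : finType) (K : nat) (b c : R) :
  #|V|%:R * b <= 1 -> 0 <= b -> #|W|%:R * c <= 1 -> 0 <= c ->
  \sum_(s <- words (index_enum (W * V)%type) K)
    b ^+ ndistinct (map snd s) * c ^+ ndistinct (map fst s) <= (K`! ^ 2)%:R.
Proof.
move=> bV b0 cW c0; elim: K => [|K IH].
  by rewrite /= big_seq1 /= /ndistinct /= !expr0 mulr1.
rewrite big_words_cons exchange_big /=.
apply: (@le_trans _ _ (\sum_(s <- words (index_enum (W * V)%type) K)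
    (K.+1 ^ 2)%:R * (b ^+ ndistinct (map snd s) * c ^+ ndistinct (map fst s)))).
  rewrite big_seq [leRHS]big_seq; apply: ler_sum => s /size_words ss.
  have hV := sum_new_letter (map snd s) bV b0.
  have hW := sum_new_letter (map fst s) cW c0.
  rewrite !size_map ss in hV hW.
  have -> : \sum_(x : W * V) b ^+ ndistinct (x.2 :: map snd s) *
      c ^+ ndistinct (x.1 :: map fst s) =
      (\sum_y b ^+ ndistinct (y :: map snd s)) *
      (\sum_x c ^+ ndistinct (x :: map fst s)).
    rewrite -(pair_bigA _ (fun x y => b ^+ ndistinct (y :: map snd s) *
      c ^+ ndistinct (x :: map fst s))) /=.
    rewrite mulr_sumr; apply: eq_bigr => x _; by rewrite mulr_suml.
  rewrite (le_trans (ler_pM _ _ hV hW))// ?sumr_ge0// => [x _|x _|];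
    rewrite ?exprn_ge0//.
  by rewrite natrX expr2 mulrACA.
rewrite -mulr_sumr factS expnMn natrM ler_wpM2l//.
Qed.

(** With weight 1/p for each distinct row and 1/n for each distinct column, the total
    weight of all walks of length K is bounded independently of p and n. This
    replaces the enumeration of walks by shape. *)
Lemma sum_walks_weights (W V : finType) (K : nat) (b c : R) :
  #|V|%:R * b <= 1 -> 0 <= b -> #|W|%:R * c <= 1 -> 0 <= c ->
  \sum_i \sum_(s <- words (index_enum (W * V)%type) K)
    b ^+ ndistinct (rows i s) * c ^+ ndistinct (cols s) <= (K.+1 * K`! ^ 2)%:R.
Proof.
move=> bV b0 cW c0; rewrite exchange_big /=.
apply: (@le_trans _ _ (\sum_(s <- words (index_enum (W * V)%type) K)
    K.+1%:R * (b ^+ ndistinct (map snd s) * c ^+ ndistinct (map fst s)))).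
  rewrite big_seq [leRHS]big_seq; apply: ler_sum => s /size_words ss.
  rewrite -mulr_suml mulrA ler_wpM2r ?exprn_ge0//.
  by have := sum_new_letter (map snd s) bV b0; rewrite size_map ss.
by rewrite -mulr_sumr natrM ler_wpM2l// sum_words_weights.
Qed.

Lemma prod_powR (N : R) (U : Type) (r : seq U) (x : U -> R) : N != 0 ->
  \prod_(e <- r) N `^ x e = N `^ (\sum_(e <- r) x e).
Proof.
move=> N0; elim: r => [|e r IH]; first by rewrite !big_nil powRr0.
by rewrite !big_cons IH powRD// N0 implybT.
Qed.

Lemma sum_count_undup (U : eqType) (r : seq U) :
  (\sum_(e <- undup r) count_mem e r)%N = size r.
Proof.
transitivity (\sum_(e <- undup r) iterop (count_mem e r) addn 1 0)%N.
  by apply: eq_bigr => e _; rewrite Monoid.iteropE iter_addn mul1n addn0.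
by rewrite big_undup_iterop_count sum1_size.
Qed.

(** Here p = N^u and n = N^(1-u), so that the weight of R distinct rows and C distinct
    columns is N^(-u R - (1-u) C). The number c(m) bounds the normalized moment
    of a cell visited m times. The exponents are compared through the number L
    of cells visited two or three times, for which this bound is weakest. *)
Lemma walk_weight (V W : eqType) (i : V) (s : seq (W * V)) (K : nat)
    (N u eps delta B : R) (c : nat -> R) :
  1 <= N -> 0 <= u -> u <= 1/2 + eps -> 0 < delta -> delta <= 1/2 ->
  3 <= K%:R * delta -> 10 * K%:R * eps = delta -> 1 <= B ->
  moving i s -> size s = K ->
  (forall m, 0 <= c m) ->
  (forall m, (0 < m <= K.*2)%N ->
     c m <= B * N `^ (eps - (if (m == 2) || (m == 3) then 1/2 + delta else 1))) ->
  \prod_(e <- undup (edges i s)) c (count_mem e (edges i s)) <=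
    B ^+ K.*2 * (N `^ (- u) ^+ ndistinct (rows i s) *
                 N `^ (u - 1) ^+ ndistinct (cols s)) * N `^ (- (delta / 2)).
Proof.
move=> N1 u0 u1 d0 d1 Kd Keps B1 mv sK c0 cB.
have N0 : N != 0 by rewrite gt_eqF// (lt_le_trans ltr01).
pose low e := let m := count_mem e (edges i s) in (m == 2) || (m == 3).
pose E := ndistinct (edges i s); pose Rw := ndistinct (rows i s).
pose C := ndistinct (cols s); pose L := count low (undup (edges i s)).
have EK : (E <= K.*2)%N by rewrite -sK -(size_edges i) size_undup.
have h1 := walk_connected mv; have h2 := walk_degree mv.
rewrite -/Rw -/C -/E in h1 h2.
have K0 : (0 < K)%N.
  by case: K Kd {Keps cB sK EK} => //; rewrite mul0r; lra.
have C1 : (1 <= C)%N.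
  case: s sK @C {mv h1 h2 low E Rw L EK} => [/= K0'|x s _]; first by rewrite -K0' in K0.
  rewrite /ndistinct; case E0 : (undup _) => //.
  have : x.1 \in undup (cols (x :: s)) by rewrite mem_undup cols_cons mem_head.
  by rewrite E0.
have LE : (L <= E)%N by exact: count_size.
have LE3 : L = E -> (K.*2 <= 3 * L)%N.
  move=> LEq; rewrite -sK -(size_edges i) -sum_count_undup.
  have /allP alow : all low (undup (edges i s)) by rewrite all_count -/L LEq.
  have -> : (3 * L = \sum_(e <- undup (edges i s)) 3)%N.
    by rewrite big_const_seq count_predT iter_addn addn0 LEq.
  rewrite big_seq [leqRHS]big_seq.
  by apply: leq_sum => e /alow /orP[/eqP->|/eqP->].
apply: (@le_trans _ _ (\prod_(e <- undup (edges i s))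
   (B * N `^ (eps - (if low e then 1/2 + delta else 1))))).
  rewrite big_seq [leRHS]big_seq; apply: ler_prod => e ein; rewrite c0 /=.
  apply: cB; rewrite -has_count has_pred1 -(mem_undup) ein /=.
  by rewrite -sK -(size_edges i) count_size.
rewrite big_split /= prod_powR// big_const_seq count_predT iter_mulr_1.
have -> : \sum_(e <- undup (edges i s)) (eps - (if low e then 1/2 + delta else 1)) =
    (eps - 1) * E%:R + (1/2 - delta) * L%:R.
  transitivity (\sum_(e <- undup (edges i s)) (eps - 1 + (1/2 - delta) * (low e)%:R)).
    by apply: eq_bigr => e _; case: (low e); rewrite ?mulr0 ?mulr1; lra.
  rewrite big_split /= -mulr_sumr big_const_seq count_predT iter_addr_0.
  rewrite -natr_sum -[X in X + _]mulr_natr; congr (_ * _ + _ * _%:R).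
  by rewrite /L -sum1_count [RHS]big_mkcond; apply: eq_bigr => e _; case: (low e).
rewrite -!(@powR_mulrn _ (N `^ _)) ?powR_ge0// -!powRrM -mulrA -!powRD ?N0 ?implybT//.
rewrite ler_pM ?powR_ge0 ?exprn_ge0 ?(le_trans ler01)//.
  by rewrite ler_weXn2l.
rewrite ler_powR//.
have K1 : 1 <= K%:R :> R by rewrite ler1n.
have e0 : 0 <= eps by nra.
have c1 : E%:R <= K%:R * 2 :> R by rewrite -natrM ler_nat muln2.
have c2 : Rw%:R + C%:R <= E%:R + 1 :> R by rewrite -natrD natr1 ler_nat.
have c3 : C%:R * 2 <= E%:R :> R by rewrite -natrM ler_nat muln2.
have c4 : L%:R <= E%:R :> R by rewrite ler_nat.
have c5 : 1 <= C%:R :> R by rewrite ler1n.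
(* The number of walks is largest for R = E + 1 - C and, when u <= 1/2, for
   C = E/2. *)
have c6 : u * Rw%:R + (1 - u) * C%:R <= u + E%:R / 2 + eps * E%:R.
  have : u * Rw%:R <= u * (E%:R + 1 - C%:R) by rewrite ler_wpM2l//; lra.
  have [u2|u2] := leP u (1/2).
    have : (1 - 2 * u) * (C%:R * 2) <= (1 - 2 * u) * E%:R by rewrite ler_wpM2l//; lra.
    have : 0 <= eps * E%:R by rewrite mulr_ge0.
    by lra.
  have : (u - 1/2) * E%:R <= eps * E%:R by rewrite ler_wpM2r//; lra.
  have : 0 <= (2 * u - 1) * C%:R by rewrite mulr_ge0//; lra.
  by lra.
have c7 : eps * E%:R <= delta / 5.
  have : eps * E%:R <= eps * (K%:R * 2) by rewrite ler_wpM2l.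
  by lra.
have c8 : eps <= delta / 10.
  have : eps * 1 <= eps * K%:R by rewrite ler_wpM2l.
  by lra.
suff : (1/2 - delta) * L%:R + u - E%:R / 2 <= - (delta / 2) - delta * 2/5 by lra.
(* E - L cells are visited once or at least four times. *)
have [h0|[h0|h0]] : L = E \/ E = L.+1 \/ (L.+2 <= E)%N.
  by move: LE; move: (L) (E); clear; lia.
- have : K%:R * 2 <= 3 * L%:R :> R by rewrite -!natrM ler_nat muln2 LE3.
  rewrite h0 => c9.
  have : delta * (K%:R * 2) <= delta * (3 * E%:R) by rewrite ler_wpM2l// ltW.
  lra.
- have : E%:R = L%:R + 1 :> R by rewrite h0 -natr1.
  move=> c9; have : delta * 1 <= delta * L%:R by rewrite ler_wpM2l//; [lra|lra].
  lra.
- have : L%:R + 2 <= E%:R :> R by rewrite -natrD ler_nat addn2.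
  move=> c9; have : 0 <= delta * L%:R by rewrite mulr_ge0// ltW.
  lra.
Qed.

End expansion.

(** * Independence and moments of products *)

Section independence.
Context {d : measure_display} {T : measurableType d} {R : realType}.
Variable P : probability T R.

Definition mfun_of d' (T' : measurableType d') (f : T -> T')
    (mf : measurable_fun setT f) : {mfun T >-> T'} :=
  HB.pack f (isMeasurableFun.Build _ _ _ _ f mf).

Lemma eq_measure_prod d1 d2 (T1 : measurableType d1) (T2 : measurableType d2)
    (m1 m2 : {measure set (T1 * T2) -> \bar R}) : (m1 setT < +oo)%E ->
  (forall A B, measurable A -> measurable B -> m1 (A `*` B) = m2 (A `*` B)) ->
  forall Q, measurable Q -> m1 Q = m2 Q.
Proof.
move=> m1oo m12.
pose C : set (set (T1 * T2)) :=
  [set C | exists A, measurable A /\ exists B, measurable B /\ C = A `*` B].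
move=> Q mQ; apply: (measure_unique C (fun=> setT)) => //.
- rewrite measurable_prod_measurableType //; congr (<<s _ >>).
  rewrite predeqE; split => [[A mA [B mB <-]]|[A [mA [B [mB ->]]]]].
    by exists A; split => //; exists B.
  by exists A => //; exists B.
- move=> /= _ _ [X1 [mX1 [X2 [mX2 ->]]]] [Y1 [mY1 [Y2 [mY2 ->]]]].
  rewrite -setXI; exists (X1 `&` Y1); split; first exact: measurableI.
  by exists (X2 `&` Y2); split => //; exact: measurableI.
- by move=> _; exists setT; split => //; exists setT; rewrite setXTT.
- exact: bigcup_const.
- by move=> A [A1 [mA1 [A2 [mA2 ->]]]]; rewrite m12.
Qed.

Definition image_measure d' (T' : measurableType d')
    (m : {measure set T -> \bar R}) (f : T -> T') (mf : measurable_fun setT f) :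
    {measure set T' -> \bar R} :=
  measure_function_pushforward__canonical__measure_function_Measure m mf.

Definition indep (U V : T -> R) := forall B D : set R,
  measurable B -> measurable D ->
  P ((U @^-1` B) `&` (V @^-1` D)) = (P (U @^-1` B) * P (V @^-1` D))%E.

(** The joint law is the product of the marginal laws, so this is Fubini's theorem. *)
Lemma indep_integral_mul (U V : T -> R) :
  measurable_fun setT U -> measurable_fun setT V ->
  P.-integrable setT (EFin \o U) -> P.-integrable setT (EFin \o V) ->
  indep U V ->
  P.-integrable setT (EFin \o (fun w => U w * V w)) /\
  (\int[P]_w (U w * V w) = (\int[P]_w U w) * (\int[P]_w V w)).
Proof.
move=> mU mV iU iV UV.
pose X : {RV P >-> R} := mfun_of mU; pose Y : {RV P >-> R} := mfun_of mV.
have mJ : measurable_fun setT (fun w => (U w, V w)) by exact: measurable_fun_pair.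
pose J : {mfun T >-> _} := mfun_of mJ.
have JE Q : measurable Q ->
    (distribution P X \x distribution P Y)%E Q = distribution P J Q.
  apply: product_measure_unique => A B mA mB /=.
  by rewrite /distribution/= /pushforward/= -UV.
pose f (z : R * R) : \bar R := (z.1 * z.2)%:E.
have mf : measurable_fun setT f.
  by apply/measurable_EFinP; apply: measurable_funM.
have intU : (\int[P]_w `|U w|%:E < +oo)%E by case/integrableP : iU.
have intV : (\int[P]_w `|V w|%:E < +oo)%E by case/integrableP : iV.
have mabs : measurable_fun setT (fun x : R => `|x|%:E) by exact/measurable_EFinP.
have dX : (\int[distribution P X]_x `|x|%:E = \int[P]_w `|U w|%:E)%E.
  by rewrite ge0_integral_distribution.
have dY : (\int[distribution P Y]_x `|x|%:E = \int[P]_w `|V w|%:E)%E.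
  by rewrite ge0_integral_distribution.
have intf : (distribution P X \x distribution P Y)%E.-integrable setT f.
  apply/integrable12ltyP => //.
  under eq_integral => x _.
    under eq_integral => y _ do rewrite /f /= normrM EFinM.
    rewrite ge0_integralZl//.
    over.
  rewrite ge0_integralZr//.
    by rewrite dX dY lte_mul_pinfty// ?integral_ge0// ge0_fin_numE// integral_ge0.
  exact: integral_ge0.
have intUV : P.-integrable setT (EFin \o (fun w => U w * V w)).
  apply/integrableP; split; first exact/measurable_EFinP/measurable_funM.
  have := intf => /integrableP[_].
  rewrite (@eq_measure_integral _ _ _ setT (distribution P J)); last first.
    by move=> Q mQ _; exact: JE.
  by rewrite ge0_integral_distribution//; exact: measurableT_comp.
split=> //; rewrite /Rintegral.
have -> : (\int[P]_w (U w * V w)%:E = \int[distribution P J]_z f z)%E.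
  by rewrite integral_distribution.
have -> : (\int[distribution P J]_z f z =
    \int[product_measure1 (distribution P X) (distribution P Y)]_z f z)%E.
  by apply: eq_measure_integral => Q mQ _; exact/esym/JE.
rewrite -integral12_prod_meas1//.
have fX : (distribution P X).-integrable setT (EFin : R -> \bar R).
  by apply/integrableP; split => //; rewrite /= dX.
have fY : (distribution P Y).-integrable setT (EFin : R -> \bar R).
  by apply/integrableP; split => //; rewrite /= dY.
have -> : (\int[distribution P X]_x \int[distribution P Y]_y f (x, y) =
    \int[distribution P X]_x (x%:E * \int[distribution P Y]_y y%:E))%E.
  apply: eq_integral => x _; rewrite -integralZl//.
have EV : (\int[distribution P Y]_y y%:E = \int[P]_w (V w)%:E)%E.
  by rewrite integral_distribution.
have EU : (\int[distribution P X]_y y%:E = \int[P]_w (U w)%:E)%E.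
  by rewrite integral_distribution.
have fV : (\int[P]_w (V w)%:E)%E \is a fin_num by exact: integrable_fin_num.
have fU : (\int[P]_w (U w)%:E)%E \is a fin_num by exact: integrable_fin_num.
by rewrite EV -(fineK fV) integralZr// EU -(fineK fU) -EFinM.
Qed.

Definition rectangle (I : choiceType) (Z : I -> T -> R) (l : seq I) (B : I -> set R) :=
  \bigcap_(i in [set` l]) (Z i @^-1` B i).

Section products.
Context (I : choiceType) (Z : I -> {RV P >-> R}).
Hypothesis Zind : mutually_independent Z.
Context (f : I -> R -> R).
Hypothesis mf : forall i, measurable_fun setT (f i).

Let V (l : seq I) (w : T) : R := \prod_(e <- l) f e (Z e w).

Let mV l : measurable_fun setT (V l).
Proof.
by apply: measurable_prod => e _; apply: measurableT_comp.
Qed.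

Lemma measurable_rectangle l B : (forall i, measurable (B i)) -> measurable (rectangle Z l B).
Proof.
move=> mB; apply: fin_bigcap_measurable; first exact: finite_seq.
by move=> i _; rewrite -[X in measurable X]setTI; exact: measurable_funPT.
Qed.

(** Mutual independence is only given on rectangles. To pass to products of several
    variables, the factors are moved one at a time out of the rectangle: the
    joint law of a factor and of the remaining product, restricted to the
    event, is determined by its values on rectangles, where the induction
    hypothesis applies to the rectangle with one side more. *)
Lemma rectangle_indep_prod (l l' : seq I) (B : I -> set R) (D : set R) :
  uniq (l ++ l') -> (forall i, measurable (B i)) -> measurable D ->
  P (rectangle Z l' B `&` (V l @^-1` D)) = (P (rectangle Z l' B) * P (V l @^-1` D))%E.
Proof.
elim: l l' B D => [|e l IH] l' B D ul mB mD.
  have -> : V [::] = cst 1 by apply/funext => w; rewrite /V big_nil.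
  rewrite preimage_cst; case: ifP => _.
    by rewrite setIT probability_setT mule1.
  by rewrite setI0 measure0 mule0.
pose V1 w := f e (Z e w).
have mV1 : measurable_fun setT V1 by exact: measurableT_comp.
pose J w := (V1 w, V l w).
have mJ : measurable_fun setT J by exact: measurable_fun_pair.
have mH := measurable_rectangle l' mB.
have VE : V (e :: l) = (fun z : R * R => z.1 * z.2) \o J.
  by apply/funext => w; rewrite /V big_cons.
have mmul : measurable_fun setT (fun z : R * R => z.1 * z.2) by exact: measurable_funM.
have mQ : measurable ((fun z : R * R => z.1 * z.2) @^-1` D).
  by rewrite -[X in measurable X]setTI; exact: mmul.
have fPH : P (rectangle Z l' B) \is a fin_num by exact: fin_num_measure.
pose c : {nonneg R} := NngNum (fine_ge0 (measure_ge0 P (rectangle Z l' B))).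
have /andP[el' /andP[ell ul']] : [&& e \notin l', e \notin l & uniq (l ++ l')].
  by move: ul; rewrite /= mem_cat negb_or -andbA => /and3P[-> -> ->].
rewrite VE !comp_preimage setIC.
transitivity (image_measure (mrestr P mH) mJ ((fun z : R * R => z.1 * z.2) @^-1` D)) => //.
transitivity (mscale c (image_measure P mJ) ((fun z : R * R => z.1 * z.2) @^-1` D));
  last by rewrite /mscale/= fineK.
apply: eq_measure_prod mQ => [|A A' mA mA'].
  rewrite /= /pushforward preimage_setT /mrestr setTI ltey_eq fPH//.
have mfA : measurable (f e @^-1` A) by rewrite -[X in measurable X]setTI; exact: mf.
have JAA' : J @^-1` (A `*` A') = V1 @^-1` A `&` V l @^-1` A' by [].
rewrite -[RHS]/((fine (P (rectangle Z l' B)))%:E * P (J @^-1` (A `*` A')))%E fineK//.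
rewrite -[LHS]/(P (J @^-1` (A `*` A') `&` rectangle Z l' B)) JAA'.
(* The sides of the rectangle extended by the coordinate e. *)
pose B' i := if i == e then f e @^-1` A else B i.
have mB' i : measurable (B' i) by rewrite /B'; case: ifP.
have HB' : rectangle Z (e :: l') B' = rectangle Z l' B `&` V1 @^-1` A.
  apply/seteqP; split=> w /=.
    move=> h; split.
      move=> i /= il'; have := h i; rewrite /= inE il' orbT => /(_ isT).
      by rewrite /B'; case: eqP => // ie; rewrite -ie il' in el'.
    by have := h e; rewrite /= inE eqxx /B' eqxx; exact.
  move=> [h hA] i /=; rewrite inE /B' => /predU1P[->|il']; first by rewrite eqxx.
  by case: eqP => [ie|_]; [rewrite -ie il' in el'|exact: h].
have He : rectangle Z [:: e] B' = V1 @^-1` A.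
  apply/seteqP; split=> w /=.
    by move/(_ e); rewrite /= inE eqxx /B' eqxx; exact.
  by move=> h i; rewrite /= inE => /eqP->; rewrite /B' eqxx.
have IH1 := IH (e :: l') B' A'.
have IH2 := IH [:: e] B' A'.
rewrite -He IH2//; last first.
  by rewrite cat_uniq /= orbF ell; move: ul'; rewrite cat_uniq => /and3P[->].
rewrite He.
have -> : V1 @^-1` A `&` V l @^-1` A' `&` rectangle Z l' B =
   rectangle Z (e :: l') B' `&` V l @^-1` A'.
  by rewrite HB' setIC setIA.
rewrite IH1//; last first.
  rewrite -(perm_uniq (s1 := (e :: l) ++ l'))//.
  by rewrite -(cat1s e l) -(cat1s e l') -catA perm_catCA.
rewrite muleA; congr (_ * _)%E.
have ul2 : uniq l' by move: ul'; rewrite cat_uniq => /and3P[].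
rewrite (Zind (s := e :: l'))//= ?el'// (Zind ul2)// big_cons muleC.
congr (_ * _)%E; last by rewrite /B' eqxx.
rewrite big_seq [RHS]big_seq; apply: eq_bigr => i il'; rewrite /B'.
by case: eqP => // ie; rewrite -ie il' in el'.
Qed.

Lemma integral_prod_indep (l : seq I) (b : R) : uniq l ->
  (forall i x, `|f i x| <= b) ->
  P.-integrable setT (EFin \o (fun w => \prod_(e <- l) f e (Z e w))) /\
  \int[P]_w (\prod_(e <- l) f e (Z e w)) = \prod_(e <- l) \int[P]_w f e (Z e w).
Proof.
move=> + fb; elim: l => [_|e l IH] /=.
  split; last first.
    under eq_Rintegral do rewrite big_nil.
    rewrite big_nil Rintegral_cst//.
    have -> : fine (P setT) = 1 by rewrite probability_setT.
    by rewrite mulr1.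
  have -> : EFin \o (fun w : T => \prod_(e <- [::]) f e (Z e w)) = cst 1%E.
    by apply/funext => w; rewrite /= big_nil.
  exact: finite_measure_integrable_cst.
move=> /andP[el ul]; have [il IHl] := IH ul.
have h : indep (fun w => f e (Z e w)) (V l).
  move=> A D mA mD.
  have := @rectangle_indep_prod l [:: e] (fun=> f e @^-1` A) D.
  have -> : rectangle Z [:: e] (fun=> f e @^-1` A) = (fun w => f e (Z e w)) @^-1` A.
    apply/seteqP; split=> w /=; first by move/(_ e); rewrite /= inE eqxx; exact.
    by move=> h i; rewrite /= inE => /eqP->.
  apply => //; first by rewrite cat_uniq /= orbF el ul.
  by move=> i; rewrite -[X in measurable X]setTI; exact: mf.
have ie : P.-integrable setT (EFin \o (fun w => f e (Z e w))).
  apply: measurable_bounded_integrable => //.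
  - by apply: le_lt_trans (probability_le1 P measurableT) (ltry 1).
  - exact: measurableT_comp.
  exists b; split; first exact: num_real.
  by move=> x bx w _ /=; rewrite (le_trans (fb _ _))// ltW.
have mVe : measurable_fun setT (fun w => f e (Z e w)) by exact: measurableT_comp.
have [] := @indep_integral_mul _ _ mVe (mV l) ie il h.
rewrite big_cons -IHl => h1 <-; split; last first.
  by apply: eq_Rintegral => w _; rewrite big_cons.
by congr (P.-integrable _ _): h1; apply/funext => w; rewrite /= big_cons.
Qed.

End products.


Lemma measurable_coordinates (I : eqType) (l : seq I) (f : I -> R -> R)
    (B : set R) :
  (forall i, measurable_fun setT (f i)) -> measurable B ->
  product_sigma_algebra [set x : I -> R | B (\prod_(e <- l) f e (x e))].
Proof.
move=> mf mB; pose S := g_sigma_algebraType (@cylinder R I).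
have mproj i : measurable_fun setT (fun x : S => (x : I -> R) i).
  move=> _ D mD; rewrite setTI; apply: sub_sigma_algebra.
  by exists i, D.
have mg : measurable_fun setT (fun x : S => \prod_(e <- l) f e ((x : I -> R) e)).
  by apply: measurable_prod => e _; exact: measurableT_comp.
by have := mg measurableT B mB; rewrite setTI.
Qed.

Lemma indep_fields_prod (I J : eqType) (X : I -> {RV P >-> R}) (Y : J -> {RV P >-> R})
    (l : seq I) (l' : seq J) (f : I -> R -> R) (g : J -> R -> R) :
  independent_fields X Y ->
  (forall i, measurable_fun setT (f i)) -> (forall i, measurable_fun setT (g i)) ->
  indep (fun w => \prod_(e <- l) f e (X e w)) (fun w => \prod_(e <- l') g e (Y e w)).
Proof.
move=> XY mf mg B D mB mD.
have h := XY _ _ (measurable_coordinates l mf mB) (measurable_coordinates l' mg mD).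
exact h.
Qed.

(** The product is at most the n-th power of its largest factor. *)
Lemma prod_le_sum_expr (I : eqType) (l : seq I) (x : I -> R) : (0 < size l)%N ->
  (forall i, 0 <= x i) ->
  \prod_(e <- l) x e <= \sum_(e <- l) x e ^+ size l.
Proof.
move=> l0 x0.
have [j jl jmax] : exists2 j, j \in l & forall i, i \in l -> x i <= x j.
  elim: l l0 => // i l IH _; case: l IH => [_|k l IH].
    by exists i; rewrite ?mem_head// => k; rewrite inE => /eqP->.
  have [j jl jmax] := IH isT.
  have [ij|ji] := leP (x i) (x j).
    exists j; first by rewrite inE jl orbT.
    by move=> k'; rewrite inE => /predU1P[->//|/jmax].
  exists i; first exact: mem_head.
  move=> k'; rewrite inE => /predU1P[->//|/jmax h].
  by rewrite (le_trans h)// ltW.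
apply: (@le_trans _ _ (x j ^+ size l)); last first.
  by rewrite (perm_big _ (perm_to_rem jl)) /= big_cons lerDl sumr_ge0// => i _; exact: exprn_ge0.
rewrite -[leRHS]iter_mulr_1 -count_predT -big_const_seq.
rewrite big_seq [leRHS]big_seq; apply: ler_prod => i il.
by rewrite x0 jmax.
Qed.

Lemma stationary_marginal (sigma : nat * nat -> {RV P >-> R}) e (B : set R) :
  strictly_stationary sigma -> measurable B ->
  distribution P (sigma e) B = distribution P (sigma (0, 0)%N) B.
Proof.
move=> st mB; case: e => h k.
have /(st h k) : product_sigma_algebra [set x : nat * nat -> R | B (x (0, 0)%N)].
  by apply: sub_sigma_algebra; exists (0, 0)%N, B.
by [].
Qed.

Lemma same_marginal_integral (X Y : {RV P >-> R}) (f : R -> \bar R) :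
  measurable_fun setT f -> (forall x, 0 <= f x)%E ->
  (forall B, measurable B -> distribution P X B = distribution P Y B) ->
  (\int[P]_w f (X w) = \int[P]_w f (Y w))%E.
Proof.
move=> mf f0 XY; rewrite -(ge0_integral_distribution X mf f0).
rewrite -(ge0_integral_distribution Y mf f0).
by apply: eq_measure_integral => B mB _; exact: XY.
Qed.

Lemma same_marginal_Rintegral (X Y : {RV P >-> R}) (f : R -> R) (b : R) :
  measurable_fun setT f -> (forall x, `|f x| <= b) ->
  (forall B, measurable B -> distribution P X B = distribution P Y B) ->
  \int[P]_w f (X w) = \int[P]_w f (Y w).
Proof.
move=> mf fb XY; rewrite /Rintegral.
have bi (Z : {RV P >-> R}) : P.-integrable setT (EFin \o (fun w => f (Z w))).
  apply: measurable_bounded_integrable => //.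
  - by apply: le_lt_trans (probability_le1 P measurableT) (ltry 1).
  - exact: measurableT_comp.
  exists b; split; first exact: num_real.
  by move=> x bx w _ /=; rewrite (le_trans (fb _))// ltW.
have mEf : measurable_fun setT (EFin \o f) by exact/measurable_EFinP.
rewrite -(@integral_distribution _ _ _ _ _ P X _ mEf (bi X)).
rewrite -(@integral_distribution _ _ _ _ _ P Y _ mEf (bi Y)).
by congr fine; apply: eq_measure_integral => B mB _; exact: XY.
Qed.

Section moments.
Context (sigma Z : nat * nat -> {RV P >-> R}).
Hypothesis Z_iid : iid Z.
Hypothesis sigma_stationary : strictly_stationary sigma.
Hypothesis sigma_ge0 : forall it w, 0 <= sigma it w.
Hypothesis sigma_Z_indep : independent_fields sigma Z.
Hypothesis sigma_moments : forall r : R, 0 < r ->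
       ('E_P[fun w => (sigma (0%N, 0%N) w `^ r)%R] < +oo)%E.

Definition sigma_moment (n : nat) : R := \int[P]_w (sigma (0, 0)%N w ^+ n).

Lemma sigma_power_integrable n e : (0 < n)%N ->
  P.-integrable setT (EFin \o (fun w => sigma e w ^+ n)) /\
  \int[P]_w (sigma e w ^+ n) = sigma_moment n.
Proof.
move=> n0.
have mX : measurable_fun setT (fun x : R => (`|x| ^+ n)%:E).
  apply/measurable_EFinP/measurable_funX; exact: normr_measurable.
have E e' : (\int[P]_w (sigma e' w ^+ n)%:E = \int[P]_w (`|sigma e' w| ^+ n)%:E)%E.
  by apply: eq_integral => w _; rewrite ger0_norm.
have S : (\int[P]_w (sigma e w ^+ n)%:E = \int[P]_w (sigma (0, 0)%N w ^+ n)%:E)%E.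
  have f0 (x : R) : (0 <= (`|x| ^+ n)%:E)%E by rewrite lee_fin exprn_ge0.
  rewrite !E; apply: (same_marginal_integral mX f0) => B mB.
  exact: stationary_marginal.
split; last by rewrite /sigma_moment /Rintegral S.
apply/integrableP; split.
  by apply/measurable_EFinP/measurable_funX.
under eq_integral => w _ do rewrite /= ger0_norm ?exprn_ge0//.
rewrite S; have := @sigma_moments n%:R; rewrite ltr0n => /(_ n0).
rewrite unlock; congr (_ < _)%E; apply: eq_integral => w _.
by rewrite powR_mulrn.
Qed.

Lemma sigma_moment_ge0 n : 0 <= sigma_moment n.
Proof. by apply: Rintegral_ge0 => w _; rewrite exprn_ge0. Qed.

Lemma sigma_prod_bound (l : seq (nat * nat)) : (0 < size l)%N ->
  P.-integrable setT (EFin \o (fun w => \prod_(e <- l) sigma e w)) /\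
  0 <= \int[P]_w (\prod_(e <- l) sigma e w) <= (size l)%:R * sigma_moment (size l).
Proof.
move=> l0; set n := size l.
have mprod : measurable_fun setT (fun w => \prod_(e <- l) sigma e w).
  exact: measurable_prod.
have isum : P.-integrable setT (fun w => \sum_(e <- l) (sigma e w ^+ n)%:E)%E.
  by apply: integrable_sum => // e _; have [] := sigma_power_integrable e l0.
have isum' : P.-integrable setT (EFin \o (fun w => \sum_(e <- l) (sigma e w ^+ n))).
  by congr (P.-integrable _ _): isum; apply/funext => w; rewrite /= sumEFin.
have iprod : P.-integrable setT (EFin \o (fun w => \prod_(e <- l) sigma e w)).
  apply: le_integrable isum' => //; first exact/measurable_EFinP.
  move=> w _ /=; rewrite lee_fin ger0_norm ?prodr_ge0//.
  rewrite ger0_norm ?sumr_ge0// => [|e _]; last exact: exprn_ge0.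
  exact: prod_le_sum_expr.
split=> //; apply/andP; split.
  by apply: Rintegral_ge0 => w _; rewrite prodr_ge0.
apply: (@le_trans _ _ (\int[P]_w (\sum_(e <- l) (sigma e w ^+ n)))).
  apply: le_Rintegral => // w _; exact: prod_le_sum_expr.
have -> : \int[P]_w (\sum_(e <- l) (sigma e w ^+ n)) = \sum_(e <- l) \int[P]_w (sigma e w ^+ n).
  rewrite /Rintegral; under eq_integral do rewrite -sumEFin.
  rewrite integral_sum//; last by move=> e; have [] := sigma_power_integrable e l0.
  rewrite -sum_fine// => e _.
  by apply: integrable_fin_num => //; have [] := sigma_power_integrable e l0.
rewrite (eq_bigr (fun=> sigma_moment n)) => [|e _]; last first.
  by have [] := sigma_power_integrable e l0.
by rewrite big_const_seq count_predT iter_addr_0 mulr_natl.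
Qed.

(** The independence of the two fields splits the expectation. The volatilities
    are bounded through [prod_le_sum_expr] and stationarity; the noise factorizes
    over the distinct cells, a cell met m times contributing an m-th moment. *)
Lemma field_prod_bound (phi : R -> R) (b : R) (l : seq (nat * nat)) :
  measurable_fun setT phi -> 1 <= b -> (forall x, `|phi x| <= b) -> (0 < size l)%N ->
  P.-integrable setT (EFin \o (fun w => \prod_(e <- l) (sigma e w * phi (Z e w)))) /\
  `|\int[P]_w (\prod_(e <- l) (sigma e w * phi (Z e w)))| <=
  (size l)%:R * sigma_moment (size l) *
  \prod_(e <- undup l) `|\int[P]_w (phi (Z (0, 0)%N w) ^+ count_mem e l)|.
Proof.
move=> mphi b1 phib l0.
pose f (e : nat * nat) (x : R) := phi x ^+ count_mem e l.
have mf e : measurable_fun setT (f e) by exact: measurable_funX.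
have fb e x : `|f e x| <= b ^+ size l.
  rewrite /f normrX (le_trans (_ : _ <= b ^+ count_mem e l))//.
    by rewrite lerXn2r// ?nnegrE// (le_trans ler01).
  by rewrite ler_weXn2l// count_size.
have [iV EV] := integral_prod_indep (proj1 Z_iid) mf (undup_uniq l) fb.
have [iU /andP[U0 UB]] := sigma_prod_bound l0.
have UV : indep (fun w => \prod_(e <- l) sigma e w) (fun w => \prod_(e <- undup l) f e (Z e w)).
  by apply: (indep_fields_prod l (undup l) (f := fun _ x => x)).
have mU : measurable_fun setT (fun w => \prod_(e <- l) sigma e w) by exact: measurable_prod.
have mV : measurable_fun setT (fun w => \prod_(e <- undup l) f e (Z e w)).
  by apply: measurable_prod => e _; exact: measurableT_comp.
have [i E] := indep_integral_mul mU mV iU iV UV.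
have XE w : \prod_(e <- l) (sigma e w * phi (Z e w)) =
    \prod_(e <- l) sigma e w * \prod_(e <- undup l) f e (Z e w).
  rewrite big_split /=; congr (_ * _); exact/esym/prodr_undup_exp_count.
have -> : (fun w => \prod_(e <- l) (sigma e w * phi (Z e w))) =
  (fun w => \prod_(e <- l) sigma e w * \prod_(e <- undup l) f e (Z e w)).
  by apply/funext => w.
split=> //.
rewrite E EV normrM ger0_norm// ler_pM// normr_prod ler_prod// => e _.
rewrite normr_ge0 /= le_eqVlt; apply/orP; left; apply/eqP; congr `|_|.
apply: (same_marginal_Rintegral (mf e) (fb e)) => B mB.
exact: (proj2 Z_iid).
Qed.

End moments.

End independence.

(** * Expected trace of a power *)

Section trace_moment.
Context {d : measure_display} {T : measurableType d} {R : realType}.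
Variable P : probability T R.

Lemma Rintegral_sum (U : eqType) (r : seq U) (g : U -> T -> R) :
  (forall x, x \in r -> P.-integrable setT (EFin \o g x)) ->
  P.-integrable setT (EFin \o (fun w => \sum_(x <- r) g x w)) /\
  \int[P]_w (\sum_(x <- r) g x w) = \sum_(x <- r) \int[P]_w g x w.
Proof.
elim: r => [_|x r IH h].
  split; last first.
    by rewrite big_nil; under eq_Rintegral do rewrite big_nil; rewrite Rintegral_cst// mul0r.
  have -> : EFin \o (fun w : T => \sum_(x <- [::]) g x w) = cst 0%E.
    by apply/funext => w; rewrite /= big_nil.
  exact: integrable0.
have ix := h x (mem_head _ _).
have [ir Er] : P.-integrable setT (EFin \o (fun w => \sum_(x <- r) g x w)) /\
  \int[P]_w (\sum_(x <- r) g x w) = \sum_(x <- r) \int[P]_w g x w.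
  by apply: IH => y yr; apply: h; rewrite inE yr orbT.
have E : (fun w => \sum_(y <- x :: r) g y w) = (fun w => g x w + \sum_(y <- r) g y w).
  by apply/funext => w; rewrite big_cons.
rewrite E; split; last by rewrite big_cons -Er; exact: RintegralD.
pose G w := \sum_(y <- r) g y w.
have -> : EFin \o (fun w => g x w + \sum_(y <- r) g y w) =
    ((EFin \o g x) \+ (EFin \o G))%E by [].
exact: integrableD.
Qed.

Context (sigma Z : nat * nat -> {RV P >-> R}).
Hypothesis Z_iid : iid Z.
Hypothesis sigma_stationary : strictly_stationary sigma.
Hypothesis sigma_ge0 : forall it w, 0 <= sigma it w.
Hypothesis sigma_Z_indep : independent_fields sigma Z.
Hypothesis sigma_moments : forall r : R, 0 < r ->
       ('E_P[fun w => (sigma (0%N, 0%N) w `^ r)%R] < +oo)%E.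

Definition transformed_data (phi : R -> R) (p n : nat) (w : T) : 'M[R]_(p, n) :=
  \matrix_(i < p, t < n)
    (sigma (nat_of_ord i, nat_of_ord t) w * phi (Z (nat_of_ord i, nat_of_ord t) w)).

Definition offdiag_gram (p n : nat) (X : 'M[R]_(p, n)) : 'M[R]_p :=
  X *m X^T - mxdiag_part (X *m X^T).

Definition cell (p n : nat) (e : 'I_p * 'I_n) : nat * nat :=
  (nat_of_ord e.1, nat_of_ord e.2).

Lemma cell_inj p n : injective (@cell p n).
Proof. by move=> [i t] [j s] [/val_inj -> /val_inj ->]. Qed.

Variables (phi : R -> R) (b : R) (K : nat).
Hypotheses (mphi : measurable_fun setT phi) (b1 : 1 <= b)
  (phib : forall x, `|phi x| <= b) (K0 : (0 < K)%N).

(** The trace only involves closed walks; their number is bounded by that of all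
    walks with a given starting row. *)
Lemma trace_moment p n :
  P.-integrable setT
    (EFin \o (fun w => \tr (offdiag_gram (transformed_data phi p n w) ^+ K))) /\
  \int[P]_w \tr (offdiag_gram (transformed_data phi p n w) ^+ K) <=
  \sum_(i < p) \sum_(s <- words (index_enum ('I_n * 'I_p)%type) K)
    (moving i s)%:R * ((K.*2)%:R * sigma_moment sigma K.*2 *
     \prod_(e <- undup (edges i s))
       `|\int[P]_w (phi (Z (0, 0)%N w) ^+ count_mem e (edges i s))|).
Proof.
pose W := words (index_enum ('I_n * 'I_p)%type) K.
pose c (i : 'I_p) (s : seq ('I_n * 'I_p)) : R :=
  (moving i s && (last i (map snd s) == i))%:R.
pose g (i : 'I_p) (s : seq ('I_n * 'I_p)) (w : T) : R :=
  \prod_(e <- map (@cell p n) (edges i s)) (sigma e w * phi (Z e w)).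
have trE w : \tr (offdiag_gram (transformed_data phi p n w) ^+ K) =
    \sum_(i < p) \sum_(s <- W) c i s * g i s w.
  apply: eq_bigr => i _; rewrite offdiag_power; apply: eq_bigr => s _.
  by congr (_ * _); rewrite /g big_map; apply: eq_bigr => e _; rewrite !mxE.
have gP i s : s \in W -> P.-integrable setT (EFin \o g i s) /\
    `|\int[P]_w g i s w| <= (K.*2)%:R * sigma_moment sigma K.*2 *
     \prod_(e <- undup (edges i s))
       `|\int[P]_w (phi (Z (0, 0)%N w) ^+ count_mem e (edges i s))|.
  move=> /size_words sK.
  have sl : size (map (@cell p n) (edges i s)) = K.*2 by rewrite size_map size_edges sK.
  have := @field_prod_bound _ _ _ P sigma Z Z_iid sigma_stationary sigma_ge0 sigma_Z_indep
    sigma_moments phi b (map (@cell p n) (edges i s)) mphi b1 phib.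
  rewrite sl double_gt0 => /(_ K0) [h1 h2]; split=> //.
  rewrite (le_trans h2)// (undup_map_inj (@cell_inj p n)) big_map.
  rewrite le_eqVlt; apply/orP; left; apply/eqP; congr (_ * _).
  apply: eq_bigr => e _; rewrite count_map.
  have ce : preim (@cell p n) (pred1 (cell e)) =1 pred1 e.
    by move=> e' /=; exact: inj_eq (@cell_inj p n) _ _.
  by rewrite (eq_count ce).
have cgP i s : s \in W -> P.-integrable setT (EFin \o (fun w => c i s * g i s w)).
  move=> sW; have -> : EFin \o (fun w => c i s * g i s w) = (fun w => (c i s)%:E * (EFin \o g i s) w)%E.
    by apply/funext => w.
  by apply: integrableZl => //; case: (gP i s sW).
have inner i := Rintegral_sum (g := fun s w => c i s * g i s w) (cgP i).
have [iO EO] := Rintegral_sum (r := index_enum 'I_p)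
   (g := fun i w => \sum_(s <- W) c i s * g i s w) (fun i _ => proj1 (inner i)).
have fE : (fun w => \tr (offdiag_gram (transformed_data phi p n w) ^+ K)) =
  (fun w => \sum_(i < p) \sum_(s <- W) c i s * g i s w).
  by apply/funext => w; exact: trE.
rewrite fE; split=> //; rewrite EO; apply: ler_sum => i _.
rewrite (proj2 (inner i)) big_seq [leRHS]big_seq; apply: ler_sum => s sW.
have [igs bgs] := gP i s sW.
rewrite RintegralZl// /c; case: (moving i s) => /=; last by rewrite !mul0r.
rewrite mul1r (le_trans _ bgs)// (le_trans (ler_norm _))// normrM.
by case: eqP => _; rewrite ?normr1 ?mul1r// normr0 mul0r.
Qed.

Definition trace_const (B : R) : R :=
  (K.*2)%:R * sigma_moment sigma K.*2 * B ^+ K.*2 * (K.+1 * K`! ^ 2)%:R.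

(** Dividing every visit of a cell by a0 turns the moments into the normalized
    ones of [walk_weight]; the weights of the walks then sum up to a constant. *)
Lemma trace_moment_bound p n (a0 N u eps delta B : R) :
  0 < a0 -> 1 <= N -> 0 <= u -> u <= 1/2 + eps -> 0 < delta -> delta <= 1/2 ->
  3 <= K%:R * delta -> 10 * K%:R * eps = delta -> 1 <= B ->
  p%:R = N `^ u -> n%:R = N `^ (1 - u) ->
  (forall m, (0 < m <= K.*2)%N -> `|\int[P]_w (phi (Z (0, 0)%N w) ^+ m)| <=
     a0 ^+ m * (B * N `^ (eps - (if (m == 2) || (m == 3) then 1/2 + delta else 1)))) ->
  \int[P]_w \tr (offdiag_gram (transformed_data phi p n w) ^+ K) <=
    a0 ^+ K.*2 * (trace_const B * N `^ (- (delta / 2))).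
Proof.
move=> a00 N1 u0 u1 d0 d1 Kd Keps B1 pE nE cB.
have N0 : N != 0 by rewrite gt_eqF// (lt_le_trans ltr01).
have [_ h] := trace_moment p n; apply: (le_trans h).
pose c m : R := `|\int[P]_w (phi (Z (0, 0)%N w) ^+ m)| / a0 ^+ m.
have an m : 0 < a0 ^+ m by rewrite exprn_gt0.
have c0 m : 0 <= c m by rewrite divr_ge0// ltW.
have cB' m : (0 < m <= K.*2)%N ->
     c m <= B * N `^ (eps - (if (m == 2) || (m == 3) then 1/2 + delta else 1)).
  by move=> /cB h'; rewrite /c ler_pdivrMr// mulrC.
have [S0 S0E] : exists S0, S0 = (K.*2)%:R * sigma_moment sigma K.*2 by eexists.
have a00' := ltW a00; have B0 : 0 <= B by rewrite (le_trans ler01).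
have S00 : 0 <= S0 by rewrite S0E mulr_ge0// sigma_moment_ge0.
apply: (@le_trans _ _ (\sum_(i < p) \sum_(s <- words (index_enum ('I_n * 'I_p)%type) K)
   (a0 ^+ K.*2 * S0 * B ^+ K.*2 * N `^ (- (delta / 2))) *
   (N `^ (- u) ^+ ndistinct (rows i s) * N `^ (u - 1) ^+ ndistinct (cols s)))).
  apply: ler_sum => i _; rewrite big_seq [leRHS]big_seq; apply: ler_sum => s /size_words sK.
  have r0 : 0 <= a0 ^+ K.*2 * S0 * B ^+ K.*2 * N `^ (- (delta / 2)) *
   (N `^ (- u) ^+ ndistinct (rows i s) * N `^ (u - 1) ^+ ndistinct (cols s)).
    by rewrite !mulr_ge0 ?exprn_ge0 ?powR_ge0.
  have [mv|] := boolP (moving i s); last by rewrite mul0r.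
  rewrite mul1r.
  have := walk_weight N1 u0 u1 d0 d1 Kd Keps B1 mv sK c0 cB'.
  have -> : \prod_(e <- undup (edges i s)) c (count_mem e (edges i s)) =
     (\prod_(e <- undup (edges i s))
       `|\int[P]_w (phi (Z (0, 0)%N w) ^+ count_mem e (edges i s))|) / a0 ^+ K.*2.
    rewrite /c big_split /=; congr (_ * _).
    by rewrite prodfV prodrXr sum_count_undup size_edges sK.
  rewrite ler_pdivrMr// => hw.
  have := ler_wpM2l S00 hw; rewrite -S0E => /le_trans; apply.
  rewrite le_eqVlt; apply/orP; left; apply/eqP; ring.
under eq_bigr do rewrite -mulr_sumr.
rewrite -mulr_sumr.
have hV : #|'I_p|%:R * N `^ (- u) <= 1.
  by rewrite card_ord pE -powRD ?N0 ?implybT// subrr powRr0.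
have hW : #|'I_n|%:R * N `^ (u - 1) <= 1.
  rewrite card_ord nE -powRD ?N0 ?implybT//.
  by have -> : 1 - u + (u - 1) = 0 :> R by [ring]; rewrite powRr0.
have := sum_walks_weights K hV (powR_ge0 _ _) hW (powR_ge0 _ _).
rewrite /trace_const -S0E => hs.
have c00 : 0 <= a0 ^+ K.*2 * S0 * B ^+ K.*2 * N `^ (- (delta / 2)).
  by rewrite !mulr_ge0 ?exprn_ge0 ?powR_ge0.
have := ler_wpM2l c00 hs => /le_trans; apply.
rewrite le_eqVlt; apply/orP; left; apply/eqP; ring.
Qed.

End trace_moment.

(** * Truncation and a tail bound for the gap *)

Section truncation.
Context {d : measure_display} {T : measurableType d} {R : realType}.
Variable P : probability T R.

Definition truncate (b x : R) : R := if `|x| <= b then x else 0.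

Lemma measurable_truncate b : measurable_fun setT (truncate b).
Proof.
apply: measurable_fun_ifT => //.
by apply: measurable_fun_ler => //; exact: normr_measurable.
Qed.

Lemma truncate_bound b x : 0 <= b -> `|truncate b x| <= b.
Proof. by rewrite /truncate; case: ifP => // _; rewrite normr0. Qed.

Lemma union_bound (U : eqType) (r : seq U) (A : U -> set T) (c : \bar R) :
  (forall x, measurable (A x)) -> (forall x, P (A x) <= c)%E ->
  (P (\big[setU/set0]_(x <- r) A x) <= (size r)%:R%:E * c)%E.
Proof.
move=> mA Ac; elim: r => [|x r IH]; first by rewrite big_nil measure0 mul0e.
rewrite big_cons; apply: le_trans.
  by apply: measureU2 => //; exact: bigsetU_measurable.
have c0 : (0 <= c)%E by rewrite (le_trans _ (Ac x)).
by rewrite /= -natr1 EFinD ge0_muleDl ?lee_fin// mul1e addeC leeD.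
Qed.

Lemma markov_ge0 (f : T -> R) (t : R) : P.-integrable setT (EFin \o f) ->
  (forall w, 0 <= f w) -> 0 < t ->
  (P [set w | (t <= f w)%R] <= ((\int[P]_w f w) / t)%:E)%E.
Proof.
move=> iF f0 t0.
have mf : measurable_fun setT f by apply/measurable_EFinP; case/integrableP : iF.
pose X : {RV P >-> R} := mfun_of mf.
have := @markov _ _ _ P X id t t0 (@measurable_id _ _ _) (fun r h => h)
  (fun x y _ _ h => h).
have -> : [set w | (t%:E <= `|(X w)%:E|)%E] = [set w | t <= f w].
  by apply/seteqP; split=> w /=; rewrite lee_fin ger0_norm.
have -> : ('E_P[id \o (fun x => `|x|%R) \o X] = (\int[P]_w f w)%R%:E)%E.
  rewrite unlock /Rintegral fineK; last exact: integrable_fin_num.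
  by apply: eq_integral => w _ /=; rewrite ger0_norm.
by move=> h; rewrite mulrC EFinM lee_pdivlMl.
Qed.

Context (sigma Z : nat * nat -> {RV P >-> R}).
Hypothesis Z_iid : iid Z.
Hypothesis sigma_stationary : strictly_stationary sigma.
Hypothesis sigma_ge0 : forall it w, 0 <= sigma it w.
Hypothesis sigma_Z_indep : independent_fields sigma Z.
Hypothesis sigma_moments : forall r : R, 0 < r ->
       ('E_P[fun w => (sigma (0%N, 0%N) w `^ r)%R] < +oo)%E.

Definition gram (p n : nat) (w : T) : 'M[R]_p :=
  sv_data sigma Z p n w *m (sv_data sigma Z p n w)^T.

Lemma gram_sym p n w : (gram p n w)^T = gram p n w.
Proof. by rewrite /gram trmx_mul trmxK. Qed.

Lemma measurable_gram p n i j : measurable_fun setT (fun w => gram p n w i j).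
Proof.
under eq_fun do rewrite mxE.
apply: measurable_sum => t; under eq_fun do rewrite !mxE.
by apply: measurable_funM; apply: measurable_funM.
Qed.

(** If no entry exceeds b, truncation changes nothing, and a gap above e a0^2
    forces the trace to be at least (e a0^2 / M)^K. The two terms are the union
    bound and Markov's inequality. *)
Lemma gap_probability (p n K : nat) (A : 'M[R]_p) (M a0 e b : R) :
  sym_posdef A -> spectral_norm A <= M -> 0 < M -> 0 < a0 -> 0 < e -> 1 <= b ->
  (0 < K)%N -> ~~ odd K ->
  (P [set w | (e < `|a0 ^- 2 * eigval_gap A (gram p n w)|)%R] <=
   (p * n)%:R%:E * P [set w | (b < `|Z (0, 0)%N w|)%R] +
   ((\int[P]_w \tr (offdiag_gram (transformed_data sigma Z (truncate b) p n w) ^+ K)) /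
      (e * a0 ^+ 2 / M) ^+ K)%:E)%E.
Proof.
move=> posA AM M0 a00 e0 b1 K0 evK.
have b0 : 0 <= b by exact: le_trans b1.
pose tF w := \tr (offdiag_gram (transformed_data sigma Z (truncate b) p n w) ^+ K).
have [itF _] := trace_moment Z_iid sigma_stationary sigma_ge0 sigma_Z_indep sigma_moments
  (measurable_truncate b) b1 (fun x => truncate_bound x b0) K0 p n.
have odsym (X : 'M[R]_(p, n)) : (offdiag_gram X)^T = offdiag_gram X.
  by rewrite /offdiag_gram linearB /= mxdiag_part_sym trmx_mul trmxK.
have tF0 w : 0 <= tF w by apply: trace_even_power_ge0.
pose t := e * a0 ^+ 2 / M.
have t0 : 0 < t by rewrite divr_gt0// mulr_gt0// exprn_gt0.
pose B (it : 'I_p * 'I_n) := [set w | (b < `|Z (cell it) w|)%R].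
have mB it : measurable (B it).
  exact/measurable_superlevel/measurable_abs.
have mE : measurable [set w | (e < `|a0 ^- 2 * eigval_gap A (gram p n w)|)%R].
  apply/measurable_superlevel/measurable_abs/measurable_funM => //.
  apply: (measurable_eigval_gap posA AM).
  - exact: ltW.
  - exact: gram_sym.
  - exact: measurable_gram.
have mtF : measurable [set w | t ^+ K <= tF w].
  apply: measurable_superlevel_large.
  by apply/measurable_EFinP; case/integrableP : itF.
have mUB : measurable (\big[setU/set0]_(it <- index_enum ('I_p * 'I_n)%type) B it).
  exact: bigsetU_measurable.
apply: (@le_trans _ _ (P (\big[setU/set0]_(it <- index_enum ('I_p * 'I_n)%type) B it `|`
     [set w | t ^+ K <= tF w]))).
  apply: le_measure; rewrite ?inE//; first exact: measurableU.
  move=> w /= ew; apply: contrapT => /not_orP[nB /negP]; rewrite -ltNge => ltF.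
  have Zb (it : 'I_p * 'I_n) : `|Z (cell it) w| <= b.
    rewrite leNgt; apply/negP => h; apply: nB.
    by rewrite -bigcup_seq; exists it; rewrite /= ?mem_index_enum.
  have XE : sv_data sigma Z p n w = transformed_data sigma Z (truncate b) p n w.
    by apply/matrixP => i j; rewrite !mxE /truncate (Zb (i, j)).
  have hgap : eigval_gap A (gram p n w) <= M * t.
    apply: eigval_gap_le; first by rewrite mulr_ge0// ltW.
    apply: (eigval_diag_trace_bound posA AM (gram_sym _ _ _) K0 evK (ltW t0)).
    by rewrite /gram XE ltW.
  move: ew; rewrite ltNge => /negP; apply.
  rewrite ger0_norm; last by rewrite mulr_ge0 ?eigval_gap_ge0// invr_ge0 exprn_ge0// ltW.
  rewrite mulrC ler_pdivrMr ?exprn_gt0//; apply: (le_trans hgap).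
  by rewrite /t mulrC divfK// gt_eqF.
apply: le_trans; first exact: measureU2.
apply: leeD; last by apply: markov_ge0 => //; rewrite exprn_gt0.
have h := @union_bound _ (index_enum ('I_p * 'I_n)%type) B
   (P [set w | (b < `|Z (0, 0)%N w|)%R]) mB.
have -> : (p * n = size (index_enum ('I_p * 'I_n)%type))%N.
  by rewrite [index_enum _]unlock -enumT -cardT card_prod !card_ord.
apply: h => it; rewrite le_eqVlt; apply/orP; left; apply/eqP.
pose D : set R := [set x | b < `|x|].
have mD : measurable D.
  apply: (@measurable_superlevel _ _ R (fun x : R => `|x|)).
  exact: normr_measurable.
exact: (proj2 Z_iid (cell it) (0, 0)%N D mD).
Qed.

End truncation.

(** * Slowly varying functions *)

Section uniform_convergence.
Context {R : realType}.
Let mu := @lebesgue_measure R.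

Lemma lebesgue_measure_shift (s : R) (A : set R) : measurable A ->
  mu ((fun x => x - s) @^-1` A) = mu A.
Proof.
move=> mA.
have ms : measurable_fun setT (fun x : R => x - s).
  by apply: measurable_funB => //; exact: measurable_cst.
have ms' : measurable_fun (setT : set (measurableTypeR R))
    (fun x : measurableTypeR R => (x - s : R) : measurableTypeR R) by exact: ms.
have := @lebesgue_measure_unique R (image_measure mu ms').
move=> /(_ _ _ mA) h; apply/esym/h => X.
move=> [[a b] _ <-] /=; rewrite /pushforward.
have -> : (fun x => x - s) @^-1` `]a, b] = `]a + s, b + s]%classic.
  by apply/seteqP; split => x /=; rewrite !in_itv /= ltrBrDr lerBlDr.
rewrite /mu !lebesgue_measure_itv /= !lte_fin ltrD2r; case: ifP => // _.
by rewrite -!EFinB opprD addrACA subrr addr0.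
Qed.

(** Every point lies in all but finitely many of the sets, so their tail
    intersections increase to [0, 2]. *)
Lemma measure_eventually_large (V : nat -> set R) :
  (forall n, measurable (V n)) ->
  (forall n, V n `<=` `[0, 2]%classic) ->
  (forall x : R, 0 <= x <= 2 -> \forall n \near \oo, V n x) ->
  \forall n \near \oo, ((3/2)%:E < mu (V n))%E.
Proof.
move=> mV V2 Vx.
pose D k := \bigcap_(m in [set m | (k <= m)%N]) V m.
have mD k : measurable (D k) by apply: bigcap_measurableType => m _.
have DE : \bigcup_k D k = `[0, 2]%classic.
  apply/seteqP; split=> x.
    by move=> [k _ Dkx]; apply: (V2 k); apply: Dkx => /=.
  rewrite /= in_itv /= => /Vx[k _ kP]; exists k => // m /= km; exact: kP.
have ndD : nondecreasing_seq D.
  move=> k l kl; apply/subsetPset => x Dx m /= lm; apply: Dx => /=.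
  exact: leq_trans kl lm.
have mUD : measurable (\bigcup_k D k) by rewrite DE; exact: measurable_itv.
have mu2 : mu (\bigcup_n D n) = 2%:E.
  by rewrite DE /mu lebesgue_measure_itv /= lte_fin ltr0n /= oppr0 adde0.
have cv : mu \o D @ \oo --> 2%:E.
  by rewrite -mu2; exact: (nondecreasing_cvg_mu (mu := mu)).
have : \forall k \near \oo, ((3/2)%:E < mu (D k))%E.
  have := cv [set y | ((3/2)%:E < y)%E]; apply.
  apply: open_nbhs_nbhs; split; first exact: open_ereal_gt_ereal.
  by rewrite /= lte_fin; lra.
apply: filterS => k /lt_le_trans; apply.
apply: le_measure; rewrite ?inE; [exact: mD|exact: mV|].
by move=> x Dx; exact: (Dx k (leqnn k)).
Qed.

(** The uniform convergence theorem for slowly varying functions in additive form.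
    If it failed along points u_n and u_n + s_n, consider the points close to
    u_n, respectively to u_n + s_n, at which h is within e/2 of its value there.
    Both sets fill most of an interval of length 2 and, translated to a common
    origin, lie in an interval of length 3, so they meet, and at a common point
    the triangle inequality contradicts the choice of u_n and s_n. *)
Lemma uniform_increments (h : R -> R) (u0 e : R) :
  measurable_fun `[u0, +oo[ h -> 0 < e ->
  (forall s, h (u + s) - h u @[u --> +oo] --> 0) ->
  exists2 U, u0 <= U & forall u s, U <= u -> 0 <= s <= 1 -> `|h (u + s) - h u| <= e.
Proof.
move=> mh e0 hs; apply: contrapT => nU.
have H n : exists us : R * R, [/\ Num.max u0 n%:R <= us.1, 0 <= us.2 <= 1 &
    e < `|h (us.1 + us.2) - h us.1|].
  apply: contrapT => nus; apply: nU; exists (Num.max u0 n%:R).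
    by rewrite le_max lexx.
  move=> u s uU s01; rewrite leNgt; apply/negP => es; apply: nus.
  by exists (u, s).
have [us usP] := choice H.
pose near_set (y : R) : set R := [set x : R | 0 <= x <= 2 /\ `|h (y + x) - h y| <= e / 2].
have mnear y : u0 <= y -> measurable (near_set y).
  move=> uy.
  have mf : measurable_fun (`[0, 2]%classic : set R) (fun x => `|h (y + x) - h y|).
    apply: measurableT_comp; first exact: normr_measurable.
    apply: measurable_funB => //.
    apply: (@measurable_comp _ _ _ _ _ _ `[u0, +oo[%classic) => //.
      move=> _ [x /= + <-]; rewrite !in_itv /= andbT => /andP[x0 _].
      by rewrite (le_trans uy)// lerDl.
    by apply: measurable_funD.
  have := mf (measurable_itv _) `]-oo, e / 2]%classic (measurable_itv _).
  have -> : near_set y = (`[0, 2]%classic : set R) `&`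
      (fun x => `|h (y + x) - h y|) @^-1` `]-oo, e / 2]%classic.
    by apply/seteqP; split=> x /=; rewrite !in_itv.
  exact.
pose V n := near_set (us n).1; pose W n := near_set ((us n).1 + (us n).2).
have u0us n : u0 <= (us n).1.
  by have [+ _ _] := usP n; rewrite ge_max => /andP[].
have u0us' n : u0 <= (us n).1 + (us n).2.
  by have [_ /andP[s0 _] _] := usP n; rewrite (le_trans (u0us n))// lerDl.
have large (y : nat -> R) : (forall n, u0 <= y n) -> (forall n, n%:R <= y n) ->
    \forall n \near \oo, ((3/2)%:E < mu (near_set (y n)))%E.
  move=> y0 yn; apply: measure_eventually_large.
  - by move=> n; exact: mnear.
  - by move=> n x [x02 _]; rewrite /= in_itv.
  move=> x x02.
  have /cvgr0Pnorm_le/(_ (e/2)) := hs x.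
  rewrite divr_gt0// => /(_ isT) [K [Kr KP]].
  near=> n; split=> //; apply: KP; apply: lt_le_trans (yn n).
  near: n; exact: nbhs_infty_gtr.
have nus n : n%:R <= (us n).1.
  by have [+ _ _] := usP n; rewrite ge_max => /andP[].
have nus' n : n%:R <= (us n).1 + (us n).2.
  by have [_ /andP[s0 _] _] := usP n; rewrite (le_trans (nus n))// lerDl.
have [n [Vn Wn]] : exists n, ((3/2)%:E < mu (V n))%E /\ ((3/2)%:E < mu (W n))%E.
  have := filterI (large _ u0us nus) (large _ u0us' nus').
  by move=> [n _ nP]; exists n; apply: nP => /=.
have [_ /andP[s0 s1] eus] := usP n.
pose s := (us n).2; pose W' := (fun x => x - s) @^-1` W n.
have mVn : measurable (V n) by exact: mnear.
have mWn : measurable (W n) by exact: mnear.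
have mW' : measurable W'.
  have ms : measurable_fun setT (fun x : R => x - s).
    by apply: measurable_funB => //; exact: measurable_cst.
  by rewrite -[W']setTI; exact: ms.
have dis : V n `&` W' = set0.
  apply/seteqP; split=> x //= [[_ h1] [_ h2]].
  move: eus; rewrite ltNge => /negP; apply.
  have : (us n).1 + (us n).2 + (x - s) = (us n).1 + x by rewrite /s; ring.
  move=> E; rewrite E in h2.
  have -> : h ((us n).1 + (us n).2) - h (us n).1 =
    (h ((us n).1 + x) - h (us n).1) - (h ((us n).1 + x) - h ((us n).1 + (us n).2)) by ring.
  by rewrite (le_trans (ler_normB _ _))// [leRHS](splitr e) lerD.
have m3 : mu (`[0, 3]%classic : set R) = 3%:E.
  by rewrite /mu lebesgue_measure_itv /= lte_fin ltr0n /= oppr0 adde0.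
have : (mu (V n `|` W') <= 3%:E)%E.
  rewrite -m3; apply: le_measure; rewrite ?inE; [exact: measurableU|exact: measurable_itv|].
  move=> x [[/andP[x0 x2] _]|[/andP[x0 x2] _]]; rewrite /= in_itv /=; apply/andP; split; rewrite /s in x0 x2 *; lra.
have -> : mu (V n `|` W') = (mu (V n) + mu (W n))%E.
  by rewrite -(lebesgue_measure_shift s mWn); exact: measureU.
rewrite leNgt => /negP; apply.
rewrite (_ : 3%:E = (3/2)%:E + (3/2)%:E)%E; first exact: lteD.
by rewrite -EFinD; congr EFin; lra.
Unshelve. all: by end_near.
Qed.


Lemma cvg_expR_pinfty : (expR : R -> R) x @[x --> +oo] --> +oo.
Proof.
apply/cvgryPge => M; near=> x; rewrite (le_trans _ (expR_ge1Dx x))//.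
rewrite -lerBlDl; near: x; apply: nbhs_pinfty_ge; exact: num_real.
Unshelve. all: by end_near.
Qed.

(** In logarithmic coordinates the increments over bounded steps are eventually
    smaller than k/2, so ln L(exp u) grows at most like (k/2) u. *)
Lemma slowly_varying_growth (L : R -> R) (k : R) : slowly_varying L -> 0 < k ->
  \forall x \near +oo, L x <= x `^ k.
Proof.
move=> [[x0 [mL L0]] Lc] k0.
pose X := Num.max x0 1; pose u0 := ln X.
have X0 : 0 < X by rewrite lt_max ltr01 orbT.
have eX u : u0 <= u -> x0 <= expR u.
  move=> uu; apply: (@le_trans _ _ X); first by rewrite le_max lexx.
  by rewrite -[X]lnK ?posrE// ler_expR.
pose h u := ln (L (expR u)).
have mh : measurable_fun `[u0, +oo[ h.
  apply: measurableT_comp => //.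
  apply: (@measurable_comp _ _ _ _ _ _ `[x0, +oo[%classic) => //.
    move=> _ [u /= + <-]; rewrite !in_itv /= !andbT; exact: eX.
  exact: measurable_funTS.
have hs s : h (u + s) - h u @[u --> +oo] --> 0.
  have c1 : L (expR s * expR u) / L (expR u) @[u --> +oo] --> (1 : R).
    exact: (cvg_comp _ _ cvg_expR_pinfty (Lc _ (expR_gt0 s))).
  have c2 : ln (L (expR s * expR u) / L (expR u)) @[u --> +oo] --> (ln 1 : R).
    exact: (continuous_cvg _ (continuous_ln ltr01) c1).
  rewrite -ln1; apply: cvg_trans c2; apply: near_eq_cvg.
  near=> u; rewrite ln_div ?posrE ?L0//.
  - by rewrite /h expRD mulrC.
  - rewrite -expRD addrC; apply: eX; rewrite -lerBlDr; near: u.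
    by apply: nbhs_pinfty_ge; exact: num_real.
  - by apply: eX; near: u; apply: nbhs_pinfty_ge; exact: num_real.
have k20 : 0 < k / 2 by rewrite divr_gt0.
have [U uU HU] := uniform_increments mh k20 hs.
have steps (n : nat) : h (U + n%:R) <= h U + n%:R * (k / 2).
  elim: n => [|n IH]; first by rewrite addr0 mul0r addr0.
  have := HU (U + n%:R) 1; rewrite lerDl ler0n lexx ler01 => /(_ isT isT).
  rewrite ler_norml -addrA natr1 => /andP[_ h1].
  by rewrite -[in leRHS]natr1 [in leRHS]mulrDl mul1r; lra.
have linear u : U <= u -> h u <= h U + (u - U + 1) * (k / 2).
  move=> Uu; have uU0 : 0 <= u - U by rewrite subr_ge0.
  have /andP[t1 t2] := truncn_itv uU0.
  set n := Num.truncn _ in t1 t2.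
  have := HU (U + n%:R) (u - U - n%:R); rewrite lerDl ler0n => /(_ isT).
  have -> : U + n%:R + (u - U - n%:R) = u by ring.
  rewrite subr_ge0 t1 lerBlDr [1 + _]addrC natr1 (ltW t2) => /(_ isT).
  rewrite ler_norml => /andP[_ h1]; have h2 := steps n.
  have : n%:R * (k / 2) <= (u - U) * (k / 2) by rewrite ler_wpM2r// ltW.
  by rewrite mulrDl; lra.
near=> x.
have x0' : 0 < x.
  by near: x; apply: nbhs_pinfty_gt; exact: num_real.
have xU : U <= ln x.
  rewrite -ler_expR lnK ?posrE//; near: x; apply: nbhs_pinfty_ge; exact: num_real.
have xL : x0 <= x.
  by near: x; apply: nbhs_pinfty_ge; exact: num_real.
have xc : (h U + (1 - U) * (k / 2)) / (k / 2) <= ln x.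
  rewrite -ler_expR lnK ?posrE//; near: x; apply: nbhs_pinfty_ge; exact: num_real.
have := linear _ xU; rewrite /h lnK ?posrE// => hl.
rewrite -ler_ln ?posrE ?L0 ?powR_gt0// ln_powR (le_trans hl)//.
have : h U + (1 - U) * (k / 2) <= ln x * (k / 2) by rewrite -ler_pdivrMr.
rewrite /h; lra.
Unshelve. all: by end_near.
Qed.

End uniform_convergence.

(** * Regularly varying tails *)

Lemma powR_natr_infty (R : realType) (g M : R) : 0 < g ->
  \forall k \near \oo, M <= k%:R `^ g.
Proof.
move=> g0; have [M0|M0] := leP M 0.
  by near=> k; rewrite (le_trans M0)// powR_ge0.
near=> k.
have h : M `^ g^-1 <= k%:R by near: k; exact: nbhs_infty_ger.
have E : M = (M `^ g^-1) `^ g by rewrite -powRrM mulVf ?gt_eqF// powRr1// ltW.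
by rewrite E ge0_ler_powR ?nnegrE ?powR_ge0 ?(ltW g0).
Unshelve. all: by end_near.
Qed.

Section tails.
Context {d : measure_display} {T : measurableType d} {R : realType}.
Variable P : probability T R.
Variable W : {RV P >-> R}.

Definition tail (x : R) : R := fine (P [set w | x < `|W w|]).

Lemma measurable_abs_gt x : measurable [set w | x < `|W w|].
Proof.
exact/measurable_superlevel/measurable_abs.
Qed.

Lemma tailE x : P [set w | x < `|W w|] = (tail x)%:E.
Proof. by rewrite /tail fineK// fin_num_measure//; exact: measurable_abs_gt. Qed.

Lemma tail_ge0 x : 0 <= tail x.
Proof. exact: fine_ge0. Qed.

Lemma tail_antitone x y : x <= y -> tail y <= tail x.
Proof.
move=> xy; rewrite -lee_fin -!tailE.
apply: le_measure; rewrite ?inE; [exact: measurable_abs_gt..|].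
by move=> w /=; exact: le_lt_trans.
Qed.

Context (alpha qp qm : R) (L : R -> R).
Hypotheses (alpha_gt0 : 0 < alpha) (qpm1 : qp + qm = 1) (L_sv : slowly_varying L).
Hypothesis right_tail : asymptotic_to (fun x => fine (P [set w | x < W w]))
         qp (fun x => L x * x `^ (- alpha)).
Hypothesis left_tail : asymptotic_to (fun x => fine (P [set w | W w < - x]))
         qm (fun x => L x * x `^ (- alpha)).

(** The tails of W and of -W add up, and q_+ + q_- = 1. *)
Lemma two_sided_tail : tail x / (L x * x `^ (- alpha)) @[x --> +oo] --> (1 : R).
Proof.
have h1 := right_tail; have h2 := left_tail; rewrite /asymptotic_to in h1 h2.
have h : fine (P [set w | x < W w]) / (L x * x `^ (- alpha)) +
    fine (P [set w | W w < - x]) / (L x * x `^ (- alpha)) @[x --> +oo] --> (1 : R).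
  by rewrite -qpm1; exact: cvgD.
apply: cvg_trans h.
apply: near_eq_cvg; near=> x; rewrite /= -mulrDl; congr (_ * _).
have x0 : 0 <= x by near: x; exact: (nbhs_pinfty_ge (num_real _)).
have m1 : measurable [set w | x < W w].
  exact: measurable_superlevel.
have m2 : measurable [set w | W w < - x].
  have := @measurable_funPT _ _ _ _ W measurableT `]-oo, (- x)[%classic (measurable_itv _).
  by rewrite setTI; congr measurable; apply/seteqP; split => w /=; rewrite in_itv.
rewrite /tail -fineD ?fin_num_measure// -measureU//.
  congr (fine (P _)); apply/seteqP; split => w /=.
    by rewrite ltr_normr [_ < - W w]ltrNr => -[->//|->]; rewrite orbT.
  by rewrite ltr_normr [_ < - W w]ltrNr => /orP[]; [left|right].
by apply/seteqP; split => w //= [k1 k2]; lra.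
Unshelve. all: by end_near.
Qed.

Lemma tail_gt0 : \forall x \near +oo, 0 < tail x.
Proof.
have [[x0 [_ L0]] _] := L_sv.
have h : \forall x \near +oo, 0 < tail x / (L x * x `^ (- alpha)).
  exact: (cvgr_gt _ two_sided_tail _ ltr01).
near=> x; have : 0 < tail x / (L x * x `^ (- alpha)) by near: x.
rewrite pmulr_lgt0// invr_gt0 mulr_gt0//.
  by apply: L0; near: x; exact: (nbhs_pinfty_ge (num_real _)).
by rewrite powR_gt0//; near: x; exact: (nbhs_pinfty_gt (num_real _)).
Unshelve. all: by end_near.
Qed.

Lemma tail_doubling : tail (2 * x) / tail x @[x --> +oo] --> (2 `^ (- alpha) : R).
Proof.
have [[x0 [_ L0]] Lc] := L_sv.
pose g x := L x * x `^ (- alpha).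
have c2 : (2 * x : R) @[x --> +oo] --> +oo.
  apply/cvgryPge => M; near=> x.
  have : M <= x by near: x; exact: (nbhs_pinfty_ge (num_real _)).
  have : 0 <= x by near: x; exact: (nbhs_pinfty_ge (num_real _)).
  by lra.
have h2 : tail (2 * x) / g (2 * x) @[x --> +oo] --> (1 : R).
  exact: (cvg_comp _ _ c2 two_sided_tail).
have h1 := two_sided_tail.
have hL := Lc 2 (ltr0Sn _ _).
have h1V : (tail x / g x)^-1 @[x --> +oo] --> (1^-1 : R).
  by apply: cvgV => //; exact: oner_neq0.
have h : (tail (2 * x) / g (2 * x) * (tail x / g x)^-1) *
    (L (2 * x) / L x * 2 `^ (- alpha)) @[x --> +oo] -->
    (1 * 1^-1 * (1 * 2 `^ (- alpha)) : R).
  by apply: cvgM; apply: cvgM => //; exact: cvg_cst.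
rewrite invr1 !mul1r in h.
apply: cvg_trans h; apply: near_eq_cvg; near=> x.
have xp : 0 < x by near: x; exact: (nbhs_pinfty_gt (num_real _)).
have Lx : 0 < L x by apply: L0; near: x; exact: (nbhs_pinfty_ge (num_real _)).
have L2x : 0 < L (2 * x).
  apply: L0; have : x0 <= x by near: x; exact: (nbhs_pinfty_ge (num_real _)).
  have : `|x0| <= x by near: x; exact: (nbhs_pinfty_ge (num_real _)).
  have := ler_norm x0; lra.
have tx : 0 < tail x by near: x; exact: tail_gt0.
rewrite /= /g powRM// ?ltW//.
have p2 : 2 `^ (- alpha) != 0 :> R by rewrite gt_eqF// powR_gt0.
have px : x `^ (- alpha) != 0 by rewrite gt_eqF// powR_gt0.
have t1 := negbT (gt_eqF tx); have t2 := negbT (gt_eqF L2x); have t3 := negbT (gt_eqF Lx).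
by field; rewrite t1 t2 t3 p2 px.
Unshelve. all: by end_near.
Qed.

Lemma dyadic_shell (X x : R) : 0 < X -> X < x ->
  exists n : nat, 2 ^+ n * X < x <= 2 ^+ n.+1 * X.
Proof.
move=> X0 Xx.
have ex : exists n, x <= 2 ^+ n * X.
  exists (Num.truncn (x / X)).+1.
  rewrite -ler_pdivrMr// (le_trans (ltW (truncnS_gt _)))//.
  by rewrite -natrX ler_nat ltnW// ltn_expl.
case: (ex_minnP ex) => -[|n] hn hmin; first by move: hn; rewrite expr0 mul1r leNgt Xx.
exists n; rewrite hn andbT ltNge; apply/negP => /hmin.
by rewrite ltnn.
Qed.

(** Iterating the limit of tail(2x)/tail(x), which is less than 2^(-s), along a
    dyadic sequence. *)
Lemma tail_upper (s : R) : s < alpha ->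
  exists X, 0 < X /\ forall n, tail (2 ^+ n * X) <= (2 `^ (- s)) ^+ n.
Proof.
move=> sa.
have lt2 : 2 `^ (- alpha) < 2 `^ (- s) :> R.
  by rewrite /powR pnatr_eq0/= ltr_expR ltr_pM2r ?ltrN2// ln_gt0// ltr1n.
have h1 : \forall x \near +oo, tail (2 * x) / tail x < 2 `^ (- s).
  exact: (cvgr_lt _ tail_doubling).
have [X [_ XP]] := filterI tail_gt0 h1.
pose Y := Num.max X 0 + 1.
have YX : X < Y by rewrite /Y ltr_pwDr// le_max lexx.
have Y0 : 0 < Y by rewrite /Y ltr_wpDl// le_max lexx orbT.
exists Y; split=> // n.
have Yn k : X < 2 ^+ k * Y.
  by rewrite (lt_le_trans YX)// ler_peMl ?(ltW Y0)// exprn_ege1// ler1n.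
elim: n => [|n IH].
  rewrite !expr0 -lee_fin -tailE; apply: probability_le1; exact: measurable_abs_gt.
have [t0 t1] := XP _ (Yn n).
rewrite exprS -mulrA; move: t1; rewrite ltr_pdivrMr// => /ltW t1.
by rewrite (le_trans t1)// exprS ler_wpM2l// powR_ge0.
Qed.

(** The dyadic bound extends to all x because the tail is monotone. *)
Lemma tail_lower (s : R) : alpha < s ->
  exists X c, [/\ 0 < X, 0 < c & forall x, X < x -> c * x `^ (- s) <= tail x].
Proof.
move=> sa.
have s0 : 0 < s by exact: lt_trans sa.
have lt2 : 2 `^ (- s) < 2 `^ (- alpha) :> R.
  by rewrite /powR pnatr_eq0/= ltr_expR ltr_pM2r ?ltrN2// ln_gt0// ltr1n.
have h1 : \forall x \near +oo, 2 `^ (- s) < tail (2 * x) / tail x.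
  exact: (cvgr_gt _ tail_doubling).
have [X [_ XP]] := filterI tail_gt0 h1.
pose Y := Num.max X 0 + 1.
have YX : X < Y by rewrite /Y ltr_pwDr// le_max lexx.
have Y0 : 0 < Y by rewrite /Y ltr_wpDl// le_max lexx orbT.
have Yn k : X < 2 ^+ k * Y.
  by rewrite (lt_le_trans YX)// ler_peMl ?(ltW Y0)// exprn_ege1// ler1n.
have low n : (2 `^ (- s)) ^+ n * tail Y <= tail (2 ^+ n * Y).
  elim: n => [|n IH]; first by rewrite !expr0 !mul1r.
  have [t0 t1] := XP _ (Yn n).
  rewrite !exprS -!mulrA; move: t1; rewrite ltr_pdivlMr// => /ltW t1.
  by rewrite (le_trans _ t1)// ler_wpM2l// powR_ge0.
have tY : 0 < tail Y by have [] := XP _ YX.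
exists Y, ((2 / Y) `^ (- s) * tail Y); split=> //.
  by rewrite mulr_gt0// powR_gt0// divr_gt0.
move=> x Yx; have [n /andP[n1 n2]] := dyadic_shell Y0 Yx.
apply: le_trans (tail_antitone n2); apply: le_trans (low n.+1).
have x0 : 0 < x := lt_trans Y0 Yx.
have c1 : 0 < 2 / Y * x by rewrite mulr_gt0// divr_gt0.
have c2 : 0 < 2 ^+ n.+1 :> R by rewrite exprn_gt0.
have e1 : (2 / Y) `^ (- s) * tail Y * x `^ (- s) = (2 / Y * x) `^ (- s) * tail Y.
  by rewrite [in RHS]powRM ?divr_ge0 ?(ltW Y0) ?(ltW x0)//; ring.
have e2 : 2 `^ (- s) ^+ n.+1 = (2 ^+ n.+1) `^ (- s) :> R.
  by rewrite -powR_mulrn ?powR_ge0// -powRrM mulrC powRrM powR_mulrn.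
rewrite e1 e2 ler_wpM2r ?tail_ge0// !powRN lef_pV2 ?posrE ?powR_gt0//.
apply: ge0_ler_powR; rewrite ?nnegrE ?(ltW c1) ?(ltW c2) ?(ltW s0)//.
by rewrite mulrAC ler_pdivlMr// exprS -mulrA ler_wpM2l// ltW.
Qed.

(** On the shell 2^n X < |W| <= 2^(n+1) X the power is at most (2^(n+1) X)^r, and the
    shell has probability at most 2^(-s n) for some s strictly between r and
    alpha: the expectation is dominated by a geometric series. *)
Lemma abs_moment_integrable (r : R) : 0 < r -> r < alpha ->
  P.-integrable setT (EFin \o (fun w => `|W w| `^ r)).
Proof.
move=> r0 ra.
pose s := (r + alpha) / 2.
have [X [X0 XP]] : exists X, 0 < X /\ forall n, tail (2 ^+ n * X) <= (2 `^ (- s)) ^+ n.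
  by apply: tail_upper; rewrite /s; lra.
pose q : R := 2 `^ (r - s).
have q0 : 0 < q by rewrite powR_gt0.
have q1 : q < 1.
  by rewrite /q /powR pnatr_eq0/= -[X in _ < X]expR0 ltr_expR pmulr_llt0 ?ln_gt0 ?ltr1n// /s; lra.
pose term (n : nat) (w : T) : \bar R :=
  ((2 ^+ n.+1 * X) `^ r * \1_[set w | 2 ^+ n * X < `|W w|] w)%:E.
have term0 n w : (0 <= term n w)%E.
  by rewrite lee_fin mulr_ge0 ?powR_ge0// indicE.
have mterm n : measurable_fun setT (term n).
  apply/measurable_EFinP; apply: measurable_funM => //.
  by apply: measurable_indic; exact: measurable_abs_gt.
have mW : measurable_fun setT (fun w => `|W w| `^ r).
  apply: (measurableT_comp (measurable_powR _)).
  by apply: measurableT_comp => //; exact: normr_measurable.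
have iterm n : (\int[P]_w term n w <= ((2 * X) `^ r * q ^+ n)%:E)%E.
  have -> : (\int[P]_w term n w = ((2 ^+ n.+1 * X) `^ r)%:E * P [set w | (2 ^+ n * X < `|W w|)%R])%E.
    rewrite /term; under eq_integral do rewrite EFinM.
    rewrite ge0_integralZl//; last 2 first.
    - apply/measurable_EFinP; apply: measurable_indic; exact: measurable_abs_gt.
    - by rewrite lee_fin powR_ge0.
    by rewrite integral_indic// ?setIT//; exact: measurable_abs_gt.
  rewrite tailE -EFinM lee_fin.
  have -> : q ^+ n = (2 ^+ n) `^ r * (2 `^ (- s)) ^+ n.
    rewrite /q powRD ?pnatr_eq0 ?implybT// exprMn; congr (_ * _).
    by rewrite -!powR_mulrn ?powR_ge0// -!powRrM mulrC.
  rewrite exprS mulrAC powRM ?mulr_ge0 ?exprn_ge0 ?(ltW X0)// -mulrA ler_wpM2l ?powR_ge0//.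
  by rewrite ler_wpM2l ?powR_ge0.
have isum : (\sum_(n <oo) \int[P]_w term n w <= ((2 * X) `^ r / (1 - q))%:E)%E.
  apply: lime_le; first by apply: is_cvg_nneseries => n _ _; exact: integral_ge0.
  near=> n.
  apply: (@le_trans _ _ (\sum_(0 <= i < n) ((2 * X) `^ r * q ^+ i)%:E)%E).
    by apply: lee_sum => i _; exact: iterm.
  rewrite sumEFin lee_fin -mulr_sumr ler_wpM2l ?powR_ge0//.
  rewrite -[leRHS]mul1r ler_pdivlMr ?subr_gt0// mulrC big_mkord.
  have := subrX1 q n; rewrite -opprB -[q - 1]opprB mulNr => /oppr_inj <-.
  by rewrite lerBlDr lerDl exprn_ge0// ltW.
have key w : ((`|W w| `^ r)%:E <= (X `^ r)%:E + \sum_(n <oo) term n w)%E.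
  have s0 : (0 <= \sum_(n <oo) term n w)%E by apply: nneseries_ge0.
  have [WX|XW] := leP `|W w| X.
    rewrite (@le_trans _ _ (X `^ r)%:E)//; last by rewrite leeDl.
    by rewrite lee_fin ge0_ler_powR ?nnegrE ?(ltW r0) ?(ltW X0).
  have [n /andP[n1 n2]] := dyadic_shell X0 XW.
  apply: (@le_trans _ _ (term n w)).
    rewrite /term indicE mem_set// mulr1 lee_fin.
    by rewrite ge0_ler_powR ?nnegrE ?(ltW r0) ?mulr_ge0 ?exprn_ge0 ?(ltW X0).
  apply: (@le_trans _ _ (\sum_(n <oo) term n w)%E); last by rewrite leeDr// lee_fin powR_ge0.
  apply: (@le_trans _ _ (\sum_(0 <= i < n.+1) term i w)%E); last exact: nneseries_lim_ge.
  by rewrite big_nat_recr//= leeDr// sume_ge0.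
apply/integrableP; split; first exact/measurable_EFinP.
under eq_integral => w _ do rewrite /= ger0_norm ?powR_ge0//.
apply: (@le_lt_trans _ _ (\int[P]_w ((X `^ r)%:E + \sum_(n <oo) term n w))%E).
  apply: ge0_le_integral => //.
  - exact/measurable_EFinP.
  - by apply: emeasurable_funD => //; exact: ge0_emeasurable_sum.
rewrite ge0_integralD//; last first.
  exact: ge0_emeasurable_sum.
- by move=> w _; apply: nneseries_ge0.
- by move=> w _; rewrite lee_fin powR_ge0.
apply: (@le_lt_trans _ _ ((X `^ r)%:E * 1 + ((2 * X) `^ r / (1 - q))%:E)%E).
  apply: leeD; last by rewrite integral_nneseries.
  apply: (@le_trans _ _ ((X `^ r)%:E * P setT)%E).
    by rewrite le_eqVlt; apply/orP; left; apply/eqP; exact: integral_cst.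
  by rewrite lee_wpmul2l ?lee_fin ?powR_ge0// probability_le1.
by rewrite mule1 -EFinD ltry.
Unshelve. all: by end_near.
Qed.

(** If a_k were smaller than k^(1/alpha-e), then k times the tail at a_k would be at
    least a positive power of k, up to a constant, whereas it tends to 1. *)
Lemma quantile_lower (a : nat -> R) (e : R) :
  (forall k : nat, (0 < k)%N -> 0 < a k) ->
  k%:R * tail (a k) @[k --> \oo] --> (1 : R) ->
  0 < e -> e < alpha^-1 ->
  \forall k \near \oo, k%:R `^ (alpha^-1 - e) <= a k.
Proof.
move=> a0 ak e0 ea.
pose th := alpha^-1 - e; pose s := alpha * (1 + alpha * e / 2).
have th0 : 0 < th by rewrite subr_gt0.
have ae0 : 0 < alpha * e by rewrite mulr_gt0.
have sa : alpha < s by rewrite /s ltr_pMr// ltrDl divr_gt0.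
have sth : 0 < 1 - s * th.
  have -> : 1 - s * th = alpha * e / 2 + (alpha * e) ^+ 2 / 2.
    by rewrite /s /th; field; rewrite gt_eqF.
  by rewrite addr_gt0// divr_gt0// exprn_gt0.
have [X [c [X0 c0 low]]] := tail_lower sa.
near=> k.
have k0 : (0 < k)%N by near: k; exists 1%N.
have k0' : 0 < k%:R :> R by rewrite ltr0n.
rewrite leNgt; apply/negP => ay.
have Xy : X < k%:R `^ th.
  rewrite (@lt_le_trans _ _ (X + 1))// ?ltrDl//.
  by near: k; exact: powR_natr_infty.
have h2 : k%:R * tail (a k) < 2.
  by near: k; apply: (cvgr_lt _ ak); rewrite ltr1n.
have h3 : 2 / c <= k%:R `^ (1 - s * th) by near: k; exact: powR_natr_infty.
move: h2; rewrite ltNge => /negP; apply.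
apply: (@le_trans _ _ (k%:R * (c * (k%:R `^ th) `^ (- s)))).
  have E : k%:R `^ (1 - s * th) = k%:R * (k%:R `^ th) `^ (- s).
    rewrite powRD ?gt_eqF ?implybT// powRr1 ?ler0n// -powRrM; congr (_ * _ `^ _).
    by ring.
  by move: h3; rewrite E ler_pdivrMr// mulrC mulrCA.
rewrite ler_wpM2l ?ler0n//; apply: (le_trans (low _ Xy)).
by apply: tail_antitone; exact: ltW.
Unshelve. all: by end_near.
Qed.

End tails.

Section truncated_moments.
Context {d : measure_display} {T : measurableType d} {R : realType}.
Variable P : probability T R.
Variable W : {RV P >-> R}.

Lemma Rintegral_dominated (f g : T -> R) : measurable_fun setT f ->
  P.-integrable setT (EFin \o g) -> (forall w, `|f w| <= g w) ->
  P.-integrable setT (EFin \o f) /\ `|\int[P]_w f w| <= \int[P]_w g w.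
Proof.
move=> mf ig fg.
have iF : P.-integrable setT (EFin \o f).
  apply: le_integrable ig => //; first exact/measurable_EFinP.
  by move=> w _ /=; rewrite lee_fin (le_trans (fg w))// ler_norm.
split=> //.
apply: (le_trans (le_normr_Rintegral measurableT iF)).
apply: le_Rintegral => //.
have := integrable_abse iF; congr (P.-integrable _ _).
Qed.

Context (r : R).
Hypothesis r0 : 0 < r.
Hypothesis iWr : P.-integrable setT (EFin \o (fun w => `|W w| `^ r)).

Definition abs_moment : R := \int[P]_w (`|W w| `^ r).

Lemma abs_moment_ge0 : 0 <= abs_moment.
Proof. by apply: Rintegral_ge0 => w _; exact: powR_ge0. Qed.

Lemma tail_markov (b : R) : 0 < b -> tail W b <= abs_moment * b `^ (- r).
Proof.
move=> b0; rewrite powRN.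
have := markov_ge0 iWr (fun w => powR_ge0 _ _) (powR_gt0 r b0).
rewrite -lee_fin -tailE; apply: le_trans.
have mW : measurable_fun setT (fun w => `|W w| `^ r) by apply/measurable_EFinP; case/integrableP: iWr.
apply: le_measure; rewrite ?inE.
- exact: measurable_abs_gt.
- exact: measurable_superlevel_large.
move=> w /= bW; apply: ge0_ler_powR; rewrite ?nnegrE ?(ltW r0) ?(ltW b0)//.
exact: ltW.
Qed.

Hypothesis centered : ('E_P[fun w => (`|W w|)%R] < +oo)%E -> ('E_P[W] = 0)%E.

(** For m >= r, |x|^m is at most b^(m-r) |x|^r on [-b, b]. For m < r the untruncated
    moment is already finite. For m = 1 < r the mean of the truncated variable is
    minus that of the part beyond b, where |x| is at most b^(1-r) |x|^r. *)
Lemma truncated_moment_bound (b : R) (m : nat) : 1 <= b -> (0 < m)%N ->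
  `|\int[P]_w (truncate b (W w) ^+ m)| <=
  (1 + abs_moment) * b `^ (if m == 1 then 1 - r else Num.max (m%:R - r) 0).
Proof.
move=> b1 m0.
have b0 : 0 < b by exact: lt_le_trans b1.
have mt : measurable_fun setT (fun w => truncate b (W w) ^+ m).
  by apply: measurable_funX; apply: measurableT_comp => //; exact: measurable_truncate.
have iB (c : R) : P.-integrable setT (EFin \o (fun w => c * `|W w| `^ r)).
  exact: (integrableZl measurableT c iWr).
have intB (c : R) : \int[P]_w (c * `|W w| `^ r) = c * abs_moment by rewrite RintegralZl.
have i1 : P.-integrable setT (EFin \o (fun w => 1 + `|W w| `^ r)).
  pose g w := `|W w| `^ r.
  have -> : EFin \o (fun w => 1 + `|W w| `^ r) =
    ((EFin \o cst 1%R) \+ (EFin \o g))%E by [].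
  by apply: integrableD => //; exact: finite_measure_integrable_cst.
have int1 : \int[P]_w (1 + `|W w| `^ r) = 1 + abs_moment.
  rewrite RintegralD//; last exact: finite_measure_integrable_cst.
  rewrite Rintegral_cst//.
  have -> : fine (P setT) = 1 by rewrite probability_setT.
  by rewrite mulr1.
have low w : (m%:R < r) -> `|W w| ^+ m <= 1 + `|W w| `^ r.
  move=> mr; have [w1|w1] := leP `|W w| 1.
    by rewrite (@le_trans _ _ 1)// ?exprn_ile1// lerDl powR_ge0.
  rewrite (@le_trans _ _ (`|W w| `^ r))//; last by rewrite lerDr.
  by rewrite -powR_mulrn// ler_powR ?(ltW w1) ?(ltW mr).
have [rm|mr] := leP r m%:R.
  have bound w : `|truncate b (W w) ^+ m| <= b `^ (m%:R - r) * `|W w| `^ r.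
    rewrite normrX /truncate; case: ifP => [Wb|_]; last first.
      by rewrite normr0 expr0n gtn_eqF// mulr_ge0 ?powR_ge0.
    have [->|W0] := eqVneq (W w) 0.
      by rewrite normr0 expr0n gtn_eqF// mulr_ge0 ?powR_ge0.
    have aW0 : `|W w| != 0 by rewrite normr_eq0.
    rewrite -powR_mulrn// -{1}(subrK r m%:R) powRD ?aW0 ?implybT//.
    by rewrite ler_wpM2r ?powR_ge0// ge0_ler_powR ?subr_ge0 ?nnegrE ?(ltW b0).
  have [_ h] := Rintegral_dominated mt (iB _) bound.
  apply: (le_trans h); rewrite intB mulrC.
  have -> : (if m == 1 then 1 - r else Num.max (m%:R - r) 0) = m%:R - r.
    by case: eqP => [->//|_]; rewrite max_l// subr_ge0.
  by rewrite ler_wpM2r ?powR_ge0// lerDr.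
have [m1|m1] := eqVneq m 1.
  rewrite m1 in mr *.
  have mW : measurable_fun setT W by [].
  have [iW _] : P.-integrable setT (EFin \o W) /\ `|\int[P]_w W w| <= \int[P]_w (1 + `|W w| `^ r).
    apply: Rintegral_dominated => // w; have := low w; rewrite m1 expr1; exact.
  have EW : \int[P]_w W w = 0.
    have : ('E_P[fun w => (`|W w|)%R] < +oo)%E.
      by rewrite unlock; case/integrableP : iW.
    by move=> /centered; rewrite unlock /Rintegral => ->.
  have mt1 : measurable_fun setT (fun w => truncate b (W w)).
    by apply: measurableT_comp => //; exact: measurable_truncate.
  have [it1 _] : P.-integrable setT (EFin \o (fun w => truncate b (W w))) /\ 
      `|\int[P]_w truncate b (W w)| <= \int[P]_w `|W w|.
    apply: Rintegral_dominated => //; first exact: (integrable_abse iW).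
    by move=> w; rewrite /truncate; case: ifP => // _; rewrite normr0.
  have dom w : `|truncate b (W w) - W w| <= b `^ (1 - r) * `|W w| `^ r.
    rewrite /truncate; case: ifP => [_|/negbT]; first by rewrite subrr normr0 mulr_ge0 ?powR_ge0.
    rewrite -ltNge sub0r normrN => bW.
    have W0 : 0 < `|W w| by exact: lt_trans bW.
    rewrite -{1}(@powRr1 _ `|W w|)// -{1}(subrK r 1) powRD ?(gt_eqF W0) ?implybT//.
    rewrite ler_wpM2r ?powR_ge0// -(opprB r 1) !powRN lef_pV2 ?posrE ?powR_gt0//.
    by rewrite ge0_ler_powR ?nnegrE ?subr_ge0 ?(ltW b0) ?(ltW bW) ?(ltW mr).
  have [_ h] := Rintegral_dominated (measurable_funB mt1 mW) (iB _) dom.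
  under eq_Rintegral do rewrite expr1.
  have <- : \int[P]_w (truncate b (W w) - W w) = \int[P]_w truncate b (W w).
    by rewrite RintegralB// EW subr0.
  apply: (le_trans h); rewrite intB mulrC.
  by rewrite ler_wpM2r ?powR_ge0// lerDr.
have bound w : `|truncate b (W w) ^+ m| <= 1 + `|W w| `^ r.
  rewrite normrX (le_trans _ (low w mr))// lerXn2r ?nnegrE//.
  by rewrite /truncate; case: ifP => // _; rewrite normr0.
have [_ h] := Rintegral_dominated mt i1 bound.
apply: (le_trans h); rewrite int1 max_r ?powRr0 ?mulr1//.
by rewrite subr_le0 ltW.
Qed.

End truncated_moments.

(** * Comparison of exponents *)

Section rates.
Context {R : realType}.

Lemma powR_natr_cvg0 (g : R) : 0 < g -> k%:R `^ (- g) @[k --> \oo] --> (0 : R).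
Proof.
move=> g0; apply/cvgr0Pnorm_le => e e0; near=> k.
have h : e^-1 <= k%:R `^ g by near: k; exact: powR_natr_infty.
rewrite ger0_norm ?powR_ge0// powRN -[leRHS]invrK lef_pV2 ?posrE ?invr_gt0//.
by rewrite (lt_le_trans _ h)// invr_gt0.
Unshelve. all: by end_near.
Qed.

Lemma powR_log_ratio (x N : R) : 0 < x -> 1 < N -> x = N `^ (ln x / ln N).
Proof.
move=> x0 N1; have N0 : 0 < N by exact: lt_trans N1.
by rewrite /powR gt_eqF// divfK ?lnK// gt_eqF// ln_gt0.
Qed.

(** Since ell(n) <= n^(2 eps), p is at most n^(1 + 2 eps), and
    ln p = (ln p)/2 + (ln p)/2 is at most (1/2 + eps)(ln n + ln p). *)
Lemma dimension_exponent (ell : R -> R) (beta eps : R) (p : nat -> nat) :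
  beta <= 1 -> 0 < eps -> slowly_varying ell ->
  (p n @[n --> \oo] --> \oo) ->
  (forall n : nat, (0 < n)%N -> (p n)%:R = n%:R `^ beta * ell n%:R) ->
  \forall n \near \oo, exists u : R,
    [/\ 0 <= u, u <= 1/2 + eps, (p n)%:R = (n * p n)%:R `^ u &
        n%:R = (n * p n)%:R `^ (1 - u)].
Proof.
move=> b1 e0 sv pinf pE.
have e20 : 0 < 2 * eps by rewrite mulr_gt0.
have grow : \forall n \near \oo, ell (n%:R : R) <= n%:R `^ (2 * eps).
  have [X [_ XP]] := slowly_varying_growth sv e20.
  by near=> n; apply: XP; near: n; exact: nbhs_infty_gtr.
near=> n.
have n1 : (1 < n)%N by near: n; exists 2%N.
have n0 : 0 < n%:R :> R by rewrite ltr0n ltnW.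
have p0 : (0 < p n)%N by near: n; exact: (cvgnyPgt p).1.
have p0' : 0 < (p n)%:R :> R by rewrite ltr0n.
have p1' : 1 <= (p n)%:R :> R by rewrite ler1n.
have Nn : 1 < (n * p n)%:R :> R by rewrite ltr1n (leq_trans n1)// leq_pmulr.
have lnN : ln (n * p n)%:R = ln n%:R + ln (p n)%:R :> R by rewrite natrM lnM ?posrE.
have lnN0 : 0 < ln (n * p n)%:R :> R by rewrite ln_gt0.
have lnp0 : 0 <= ln (p n)%:R :> R by rewrite ln_ge0.
have lnn0 : 0 < ln n%:R :> R by rewrite ln_gt0// ltr1n.
have N0 : 0 < (n * p n)%:R :> R by exact: lt_trans Nn.
exists (ln (p n)%:R / ln (n * p n)%:R); split.
- by rewrite divr_ge0// ltW.
- rewrite ler_pdivrMr// lnN.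
  have : ln (p n)%:R <= (1 + 2 * eps) * ln n%:R :> R.
    have h : ell (n%:R : R) <= n%:R `^ (2 * eps) by near: n.
    have hp : (p n)%:R <= n%:R `^ (1 + 2 * eps) :> R.
      rewrite pE ?(ltnW n1)// powRD ?(gt_eqF n0) ?implybT//.
      apply: (le_trans (ler_wpM2l (powR_ge0 _ _) h)); rewrite ler_wpM2r ?powR_ge0//.
      by rewrite ler_powR// ler1n ltnW.
    by rewrite -ln_powR ler_ln ?posrE ?powR_gt0.
  have : 0 <= eps * ln (p n)%:R :> R by rewrite mulr_ge0// ltW.
  by lra.
- exact: powR_log_ratio.
- have E : 1 - ln (p n)%:R / ln (n * p n)%:R = ln n%:R / ln (n * p n)%:R :> R.
    by rewrite -{1}(@divff _ (ln (n * p n)%:R)) ?gt_eqF// -mulrBl lnN addrK.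
  by rewrite E; exact: powR_log_ratio.
Unshelve. all: by end_near.
Qed.

(** With b = N^(1/alpha+e1) and a_N >= N^(1/alpha-e1), this compares the exponent of the
    truncated moment with the normalized cost that [walk_weight] allows. As
    r is close to alpha, a moment of order m >= r has exponent close to
    m/alpha - 1; the moments of order 2 and 3 below r are bounded, and there
    2/alpha >= 1/2 + delta is used. *)
Lemma moment_exponent (alpha delta eps e1 r : R) (K m : nat) :
  0 < alpha -> alpha < 4 -> 0 < e1 -> 8 * K%:R * e1 = eps ->
  1 <= K%:R :> R -> (0 < m <= K.*2)%N ->
  0 < delta -> delta <= 1/2 -> delta <= 2 / alpha - 1/2 -> eps <= 1/20 ->
  r = alpha * (1 - alpha * e1 / 4) ->
  (alpha^-1 + e1) * (if m == 1 then 1 - r else Num.max (m%:R - r) 0) <=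
  (alpha^-1 - e1) * m%:R + (eps - (if (m == 2) || (m == 3) then 1/2 + delta else 1)).
Proof.
move=> a0 a4 e0 Ke K1 /andP[m0 mK] d0 d1 d2 eps1 rE.
have [ia iaE] : exists ia, ia = alpha^-1 by exists alpha^-1.
have [eta etaE] : exists eta, eta = alpha * e1 / 4 by exists (alpha * e1 / 4).
have ia4 : 1 < ia * 4 by rewrite iaE mulrC ltr_pdivlMr// mul1r.
have iar : ia * r = 1 - eta by rewrite rE iaE -etaE mulrA mulVf ?gt_eqF// mul1r.
have eta1 : eta <= e1.
  have : alpha * e1 <= 4 * e1 by rewrite ler_wpM2r// ltW.
  by rewrite etaE; lra.
have e1eps : 8 * e1 <= eps.
  have : e1 * 1 <= e1 * K%:R by rewrite ler_wpM2l// ltW.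
  by lra.
have me : e1 * m%:R <= eps / 4.
  have : e1 * m%:R <= e1 * (K%:R * 2) by rewrite ler_wpM2l ?(ltW e0)// -natrM ler_nat muln2.
  by lra.
have r0 : 0 < r by rewrite rE mulr_gt0// -etaE; lra.
have er : 0 <= e1 * r by rewrite mulr_ge0// ltW.
have d2' : 1/2 + delta <= ia * 2 by rewrite iaE mulrC; lra.
rewrite -iaE; clear iaE etaE d2 rE.
have main x : x <= 1 -> (ia + e1) * (m%:R - r) <= (ia - e1) * m%:R + (eps - x).
  move=> x1; rewrite mulrDl mulrDl mulNr.
  by rewrite !mulrBr iar; lra.
have m1R : 1 <= m%:R :> R by rewrite ler1n.
have [->|m1] := eqVneq m 1; first by have := main 1 (lexx _); rewrite /=; lra.
have pos x : x <= 1 -> x <= ia * m%:R -> 0 <= (ia - e1) * m%:R + (eps - x).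
  by move=> x1 xm; rewrite mulrBl; lra.
rewrite maxr_pMr; last by lra.
rewrite ge_max mulr0.
case: ifP => m2.
  rewrite main ?pos//; try lra.
  rewrite (le_trans d2')// ler_wpM2l//; first by lra.
  by rewrite ler_nat; case/orP: m2 => /eqP->.
rewrite main ?pos//.
have : 4 <= m%:R :> R by rewrite ler_nat; case: m m0 m1 m2 {mK me main m1R pos} => // -[|[|[|[]]]].
by move=> m4; rewrite (le_trans (ltW ia4))// ler_wpM2l//; lra.
Qed.

End rates.

(** * Convergence of the eigenvalues *)

Theorem theorem3p2 (R : realType) (d : measure_display) (T : measurableType d)
    (P : probability T R) (sigma Z : nat * nat -> {RV P >-> R})
    (a : nat -> R) (p : nat -> nat) (beta : R) (ell : R -> R)
    (alpha qp qm : R) (L : R -> R) (A : forall n : nat, 'M[R]_(p n))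
    (Z_iid : iid Z)
    (sigma_stationary : strictly_stationary sigma)
    (sigma_ge0 : forall it w, 0 <= sigma it w)
    (sigma_Z_indep : independent_fields sigma Z)
    (a_gt0 : forall k : nat, (0 < k)%N -> 0 < a k)
    (a_tail : k%:R * fine (P [set w | a k < `|Z (0%N, 0%N) w|])
                @[k --> \oo] --> (1 : R))
    (p_infty : p n @[n --> \oo] --> \oo)
    (ell_sv : slowly_varying ell)
    (beta_gt0 : 0 < beta) (beta_le1 : beta <= 1)
    (p_growth : forall n : nat, (0 < n)%N ->
       (p n)%:R = n%:R `^ beta * ell n%:R)
    (alpha_range : 0 < alpha < 2 \/ 2 < alpha < 4)
    (qp_ge0 : 0 <= qp) (qm_ge0 : 0 <= qm) (qpm1 : qp + qm = 1)
    (L_sv : slowly_varying L)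
    (Z_right_tail :
       asymptotic_to (fun x => fine (P [set w | x < Z (0%N, 0%N) w]))
         qp (fun x => L x * x `^ (- alpha)))
    (Z_left_tail :
       asymptotic_to (fun x => fine (P [set w | Z (0%N, 0%N) w < - x]))
         qm (fun x => L x * x `^ (- alpha)))
    (Z_centered : ('E_P[fun w => (`|Z (0%N, 0%N) w|)%R] < +oo)%E ->
       ('E_P[Z (0%N, 0%N)] = 0)%E)
    (sigma_moments : forall r : R, 0 < r ->
       ('E_P[fun w => (sigma (0%N, 0%N) w `^ r)%R] < +oo)%E)
    (A_posdef : forall n : nat, (0 < n)%N -> sym_posdef (A n))
    (A_bounded : exists M : R, forall n : nat, (0 < n)%N ->
       spectral_norm (A n) <= M) :
  cvg_in_probability0 P (fun (n : nat) (w : T) =>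
    let X := sv_data sigma Z (p n) n w in
    let S := X *m X^T in
    (a (n * p n)%N) ^- 2 *
    \big[Num.max/0]_(i < p n)
      `| eigval (mxsqrt (A n) *m S *m mxsqrt (A n)) i
         - eigval (mxdiag_part S *m A n) i |).
Proof.

have alpha0 : 0 < alpha by case: alpha_range => /andP[h1 h2]; lra.
have alpha4 : alpha < 4 by case: alpha_range => /andP[h1 h2]; lra.
pose W := Z (0, 0)%N.
pose delta : R := Num.min (1/2) (2 / alpha - 1/2).
have delta0 : 0 < delta.
  rewrite lt_min; apply/andP; split; first by lra.
  by rewrite subr_gt0 ltr_pdivlMr//; lra.
have delta1 : delta <= 1/2 by rewrite ge_min lexx.
have delta2 : delta <= 2 / alpha - 1/2 by rewrite ge_min lexx orbT.
(* K is even and at least 3 / delta, as [walk_weight] requires. *)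
pose K := (Num.truncn (3 / delta)).+1.*2.
have K0 : (0 < K)%N by [].
have evK : ~~ odd K by rewrite odd_double.
have K1 : 1 <= K%:R :> R by rewrite ler1n.
have Kd : 3 <= K%:R * delta.
  rewrite -ler_pdivrMr//; apply: (le_trans (ltW (truncnS_gt _))).
  by rewrite ler_nat /K -addnn leq_addr.
pose eps : R := delta / (10 * K%:R).
have Kgt0 : 0 < K%:R :> R by rewrite ltr0n.
have Keps : 10 * K%:R * eps = delta by rewrite /eps mulrC divfK// gt_eqF// mulr_gt0.
have eps0 : 0 < eps by rewrite divr_gt0// mulr_gt0.
have eps20 : eps <= 1/20.
  have : eps * 1 <= eps * K%:R by rewrite ler_wpM2l// ltW.
  by lra.
(* The order of a moment along a walk is at most 2K, so the errors made by
   using the exponents 1/alpha +- e1 for a_N and for the truncation level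
   add up to at most eps / 2. *)
pose e1 : R := eps / (8 * K%:R).
have e10 : 0 < e1 by rewrite divr_gt0// mulr_gt0.
have Ke1 : 8 * K%:R * e1 = eps by rewrite /e1 mulrC divfK// gt_eqF// mulr_gt0.
have e1s : e1 <= 1/160.
  have : e1 * 1 <= e1 * K%:R by rewrite ler_wpM2l// ltW.
  by lra.
have e1a : e1 < alpha^-1.
  by rewrite -[X in _ < X]mul1r ltr_pdivlMr//; nra.
(* The order r is so close to alpha that N b^(-r) still tends to 0. *)
pose eta := alpha * e1 / 4.
have eta0 : 0 < eta by rewrite divr_gt0// mulr_gt0.
have eta1 : eta <= 1/2 by rewrite /eta; nra.
pose r := alpha * (1 - alpha * e1 / 4).
have r0 : 0 < r by rewrite /r mulr_gt0// -/eta; lra.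
have ra : r < alpha by rewrite /r -/eta gtr_pMr//; lra.
have iWr : P.-integrable setT (EFin \o (fun w => `|W w| `^ r)).
  exact: (abs_moment_integrable qpm1 L_sv Z_right_tail Z_left_tail r0 ra).
pose m1 := abs_moment W r.
have m10 : 0 <= m1 by exact: abs_moment_ge0.
pose B := 1 + m1.
have B1 : 1 <= B by rewrite lerDl.
have [M0 AM0] := A_bounded.
pose M := Num.max M0 1.
have M_gt0 : 0 < M by rewrite lt_max ltr01 orbT.
have quant := quantile_lower alpha0 qpm1 L_sv Z_right_tail Z_left_tail a_gt0 a_tail e10 e1a.
have Ninf : (n * p n)%N @[n --> \oo] --> \oo.
  apply/cvgnyPge => k; near=> n.
  have k1 : (k <= n)%N by near: n; exact: nbhs_infty_ge.
  have p1 : (0 < p n)%N by near: n; exact: (cvgnyPgt p).1.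
  by rewrite (leq_trans k1)// leq_pmulr.
have quantN : \forall n \near \oo, (n * p n)%:R `^ (alpha^-1 - e1) <= a (n * p n)%N.
  exact: Ninf quant.
have dims := dimension_exponent beta_le1 eps0 ell_sv p_infty p_growth.
move=> e e0.
pose C1 := m1; pose C2 := (M / e) ^+ K * trace_const sigma K B.
pose bnd (n : nat) : R := C1 * (n * p n)%:R `^ (- eta) + C2 * (n * p n)%:R `^ (- (delta / 2)).
have bnd0 : bnd n @[n --> \oo] --> (0 : R).
  have lim (c g : R) : 0 < g -> c * (n * p n)%:R `^ (- g) @[n --> \oo] --> (0 : R).
    move=> g0; rewrite -(mulr0 c); apply: cvgMl_tmp.
    exact: (cvg_comp _ _ Ninf (powR_natr_cvg0 g0)).
  rewrite -[X in _ --> X]addr0; apply: cvgD; apply: lim => //.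
  by rewrite divr_gt0.
apply: (@squeeze_cvge _ _ _ _ (cst 0%E) _ (fun n => (bnd n)%:E)); last 2 first.
- exact: cvg_cst.
- by apply/fine_cvgP; split => //; near=> n.
near=> n; rewrite measure_ge0 /=.
have n0 : (0 < n)%N by near: n; exact: nbhs_infty_gt.
have p0 : (0 < p n)%N by near: n; exact: (cvgnyPgt p).1.
have N0 : (0 < n * p n)%N by rewrite muln_gt0 n0.
pose N : R := (n * p n)%:R.
have N1 : 1 <= N by rewrite ler1n.
have Ngt0 : 0 < N by exact: lt_le_trans N1.
have [u [u0 u1 pu nu]] : exists u : R, [/\ 0 <= u, u <= 1/2 + eps, (p n)%:R = (n * p n)%:R `^ u &
        n%:R = (n * p n)%:R `^ (1 - u)] by near: n.
have aq : (n * p n)%:R `^ (alpha^-1 - e1) <= a (n * p n)%N by near: n.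
pose a0 := a (n * p n)%N.
have a00 : 0 < a0 by exact: a_gt0.
pose b := N `^ (alpha^-1 + e1).
have ia0 : 0 < alpha^-1 by rewrite invr_gt0.
have b1 : 1 <= b.
  by rewrite -[leLHS](powRr0 N) ler_powR// addr_ge0// ltW.
have b0 : 0 < b by exact: lt_le_trans b1.
have AM : spectral_norm (A n) <= M by rewrite le_max AM0.
have gap := gap_probability Z_iid sigma_stationary sigma_ge0 sigma_Z_indep sigma_moments n
  (A_posdef n n0) AM M_gt0 a00 e0 b1 K0 evK.
have mom m : (0 < m <= K.*2)%N -> `|\int[P]_w (truncate b (Z (0, 0)%N w) ^+ m)| <=
     a0 ^+ m * (B * N `^ (eps - (if (m == 2) || (m == 3) then 1/2 + delta else 1))).
  move=> mK; have /andP[m0 _] := mK.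
  have := truncated_moment_bound iWr Z_centered b1 m0.
  rewrite -/m1 -/B => /le_trans; apply.
  rewrite mulrCA ler_wpM2l ?(le_trans ler01 B1)//.
  apply: (@le_trans _ _ (N `^ ((alpha^-1 - e1) * m%:R) *
      N `^ (eps - (if (m == 2) || (m == 3) then 1/2 + delta else 1)))).
    rewrite -powRD ?(gt_eqF Ngt0) ?implybT// -powRrM ler_powR//.
    exact: (moment_exponent alpha0 alpha4 e10 Ke1 K1 mK delta0 delta1 delta2 eps20).
  rewrite ler_wpM2r ?powR_ge0// powRrM powR_mulrn ?powR_ge0//.
  by rewrite lerXn2r ?nnegrE ?powR_ge0 ?(ltW a00).
have trb := trace_moment_bound Z_iid sigma_stationary sigma_ge0 sigma_Z_indep sigma_moments
  (measurable_truncate b) b1 (fun x => truncate_bound x (ltW b0)) K0 a00 N1 u0 u1 delta0 delta1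
  Kd Keps B1 pu nu mom.
apply: (le_trans gap).
rewrite EFinD; apply: leeD.
  rewrite tailE -EFinM lee_fin mulnC.
  apply: (le_trans (ler_wpM2l (ltW Ngt0) (tail_markov r0 iWr b0))).
  rewrite mulrCA ler_wpM2l// /b -powRrM.
  rewrite -{1}(@powRr1 _ N) ?(ltW Ngt0)// -powRD ?(gt_eqF Ngt0) ?implybT// ler_powR//.
  have -> : 1 + (alpha^-1 + e1) * - r = - 3 * eta + 4 * eta ^+ 2.
    by rewrite /r /eta; field; rewrite gt_eqF.
  by nra.
rewrite lee_fin ler_pdivrMr; last by rewrite exprn_gt0// divr_gt0// mulr_gt0// exprn_gt0.
apply: (le_trans trb); rewrite le_eqVlt; apply/orP; left; apply/eqP.
rewrite /C2 -/N -mul2n exprM.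
have -> : e * a0 ^+ 2 / M = a0 ^+ 2 * (M / e)^-1 by rewrite invf_div; ring.
have y0 : M / e != 0 by rewrite gt_eqF// divr_gt0.
move: (M / e) y0 => y y0; rewrite [(_ * y^-1) ^+ K]exprMn exprVn.
have yK : y ^+ K != 0 by rewrite expf_neq0.
by field.
Unshelve. all: by end_near.
Qed.
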